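(* Let $sm\mathfrak{U}$ be the class of all finite groups $G$ such that every Sylow subgroup of $G$ is submodular in $G$. Let $G$ be a finite group. Then the following hold: 1) if $G\in sm\mathfrak{U}$ and $H\le G$, then $H\in sm\mathfrak{U}$; 2) if $G\in sm\mathfrak{U}$ and $N\unlhd G$, then $G/N\in sm\mathfrak{U}$; 3) if $N_i\unlhd G$ and $G/N_i\in sm\mathfrak{U}$ for $i=1,2$, then $G/(N_1\cap N_2)\in sm\mathfrak{U}$; 4) if $H_i\in sm\mathfrak{U}$ and $H_i\unlhd G$ for $i=1,2$, and $H_1\cap H_2=1$, then $H_1\times H_2\in sm\mathfrak{U}$; 5) if $G/\Phi(G)\in sm\mathfrak{U}$, then $G\in sm\mathfrak{U}$; 6) the class of groups $sm\mathfrak{U}$ is a hereditary saturated formation.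
   Context: All groups are finite. A subgroup $M$ of a group $G$ is called modular in $G$ if: (1) $\langle X, M\cap Z\rangle=\langle X,M\rangle\cap Z$ for all $X\le G$, $Z\le G$ with $X\le Z$; and (2) $\langle M, Y\cap Z\rangle=\langle M,Y\rangle\cap Z$ for all $Y\le G$, $Z\le G$ with $M\le Z$. A subgroup $H$ of $G$ is called submodular in $G$ if there is a chain of subgroups $H=H_0\le H_1\le\dots\le H_s=G$ such that $H_{i-1}$ is modular in $H_i$ for $i=1,\dots,s$. $\Phi(G)$ denotes the Frattini subgroup of $G$. A class of groups (closed under isomorphism) $\mathfrak{F}$ is a formation if (a) every quotient of a group in $\mathfrak{F}$ lies in $\mathfrak{F}$, and (b) whenever $A,B$ are normal subgroups of a group $H$ with $H/A\in\mathfrak{F}$ and $H/B\in\mathfrak{F}$, then $H/(A\cap B)\in\mathfrak{F}$. A formation $\mathfrak{F}$ is hereditary if it contains all subgroups of each of its members, and saturated if $G/\Phi(G)\in\mathfrak{F}$ implies $G\in\mathfrak{F}$. *)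

(* Defs.v *)
From mathcomp Require Import all_boot all_fingroup all_solvable.

Set Implicit Arguments.
Unset Strict Implicit.
Unset Printing Implicit Defensive.

Local Open Scope group_scope.

(* Stated on sets, like [normal], so that it can be used with [.-series];
   it is only meant for M and G groups. *)
Definition modular (gT : finGroupType) (M G : {set gT}) : bool :=
  [&& M \subset G,
      [forall X : {group gT}, forall Z : {group gT},
         [&& X \subset G, Z \subset G & X \subset Z] ==>
           (X <*> (M :&: Z) == (X <*> M) :&: Z)]
    & [forall Y : {group gT}, forall Z : {group gT},
         [&& Y \subset G, Z \subset G & M \subset Z] ==>
           (M <*> (Y :&: Z) == (M <*> Y) :&: Z)]].

Arguments modular {gT} M%_g G%_g.

Definition submodular (gT : finGroupType) (H G : {group gT}) : Prop :=
  exists2 s : seq {group gT}, modular.-series H s & last H s = G.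

(* A finite group is a {group gT} in an arbitrary ambient finGroupType gT;
   closure under isomorphism across ambient types is part of [formation]. *)
Definition group_class := forall gT : finGroupType, {group gT} -> Prop.

Definition isog_closed (F : group_class) : Prop :=
  forall (gT rT : finGroupType) (G : {group gT}) (H : {group rT}),
    G \isog H -> F gT G -> F rT H.

Definition formation (F : group_class) : Prop :=
  [/\ isog_closed F,
      forall (gT : finGroupType) (G N : {group gT}),
        N <| G -> F gT G -> F _ (G / N)%G
    & forall (gT : finGroupType) (H A B : {group gT}),
        A <| H -> B <| H -> F _ (H / A)%G -> F _ (H / B)%G ->
        F _ (H / (A :&: B))%G].

Definition hereditary (F : group_class) : Prop :=
  forall (gT : finGroupType) (G H : {group gT}),
    H \subset G -> F gT G -> F gT H.

Definition saturated (F : group_class) : Prop :=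
  forall (gT : finGroupType) (G : {group gT}),
    F _ (G / 'Phi(G))%G -> F gT G.

(* For a prime p not dividing #|G| the Sylow p-subgroup is trivial, and the
   trivial subgroup is modular in every group, so including it is harmless. *)
Definition smU : group_class := fun (gT : finGroupType) (G : {group gT}) =>
  forall (p : nat) (P : {group gT}),
    prime p -> p.-Sylow(G) P -> submodular P G.

(* Main.v *)
Require Import Defs.
From mathcomp Require Import all_boot all_fingroup all_solvable all_algebra all_field all_character.

Set Implicit Arguments.
Unset Strict Implicit.
Unset Printing Implicit Defensive.

Local Open Scope group_scope.

(** Submodularity is inherited by intersections, by images under morphisms and
    by preimages under quotient maps.  So [G / N] is in smU iff [N <*> P] is
    submodular in [G] for each Sylow subgroup [P] of [G], and
    [(N1 <*> P) :&: (N2 <*> P) = (N1 :&: N2) <*> P] gives closure under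
    subdirect products.

    For saturation, let a p-group [P] act on an r-group [R], with [p != r].
    Then [P] is submodular in [R <*> P] iff [P / 'C_P(R)] is abelian of exponent
    dividing [gcd (p, r - 1)], that is, iff [R] is centralised by the subgroup
    [E] of [P] generated by its commutators and its [gcd (p, r - 1)]-th powers.
    A minimal counterexample argument and transfer show that the Sylow subgroup
    for the largest prime divisor of a group in smU is normal, so that groups in
    smU have r-length at most 1.  Now let [N] be a normal r-subgroup of [G]
    contained in ['Phi(G)] with [G / N] in smU.  Modulo a normal complement of
    [N] in the preimage of ['O_r^'(G / N)], the Sylow r-subgroup [R] is normal,
    [E] centralises [R / N], and [N \subset 'Phi(R)] by Gaschuetz's theorem; so
    [E] centralises [R / 'Phi(R)], hence [R], hence [N]. *)

(** * Modular and submodular subgroups *)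

Section ModularP.

Variable gT : finGroupType.
Implicit Types (G H K L M N X Y Z : {group gT}).

Lemma modularP G M :
  reflect [/\ M \subset G,
    forall X Z, X \subset Z -> Z \subset G ->
      X <*> (M :&: Z) = (X <*> M) :&: Z
    & forall Y Z, Y \subset G -> Z \subset G -> M \subset Z ->
      M <*> (Y :&: Z) = (M <*> Y) :&: Z]
    (modular M G).
Proof.
apply: (iffP and3P) => -[sMG m1 m2]; split=> //.
- move=> X Z sXZ sZG; apply/eqP; move/forallP/(_ X)/forallP/(_ Z)/implyP: m1.
  by apply; rewrite sXZ sZG (subset_trans sXZ).
- move=> Y Z sYG sZG sMZ; apply/eqP.
  by move/forallP/(_ Y)/forallP/(_ Z)/implyP: m2; apply; rewrite sYG sZG.
- apply/forallP=> X; apply/forallP=> Z; apply/implyP=> /and3P[_ sZG sXZ].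
  by rewrite m1.
- apply/forallP=> Y; apply/forallP=> Z; apply/implyP=> /and3P[sYG sZG sMZ].
  by rewrite m2.
Qed.

End ModularP.

Section Modular.

Variable gT : finGroupType.
Implicit Types (G H K L M N X Y Z : {group gT}).

Lemma modular_sub G M : modular M G -> M \subset G.
Proof. by case/modularP. Qed.

(** By the first law each [W] between [M :&: Y] and [Y] is [(W <*> M) :&: Y], and maximality leaves
    only [M] and [G] for [W <*> M]. *)
Lemma modular_maximal_cap G M Y :
    modular M G -> maximal M G -> Y \subset G -> ~~ (Y \subset M) ->
  maximal (M :&: Y) Y.
Proof.
move=> /modularP[sMG m1 _] maxM sYG nsYM; apply/maxgroupP; split.
  by rewrite /= properE subsetIr subsetI subxx andbT.
move=> W /= /andP[sWY nsYW] sMYW; apply/eqP; rewrite eqEsubset sMYW andbT.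
have := m1 W Y sWY sYG; rewrite (joing_idPl sMYW) => defW.
rewrite defW setSI //.
have /maximal_eqP[_ /(_ (W <*> M)%G)[||/= -> //|/= defG]] : maximal_eq M G.
- by rewrite /maximal_eq maxM orbT.
- exact: joing_subr.
- by rewrite join_subG sMG (subset_trans sWY).
by case/negP: nsYW; rewrite defW defG subsetI sYG /=.
Qed.

(** Dually, the second law recovers [Z] from [Y :&: Z], which lies between [M :&: Y] and [Y]. *)
Lemma modular_maximal G M Y :
    modular M G -> Y \subset G -> maximal (M :&: Y) Y -> M <*> Y = G ->
  maximal M G.
Proof.
move=> /modularP[sMG _ m2] sYG maxMY defG; apply/maxgroupP; split.
  rewrite /= properE sMG; apply: contraL (maxgroupp maxMY) => sGM.
  by rewrite properE subsetI subxx (subset_trans sYG sGM) /= andbF.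
move=> Z /= /andP[sZG nsGZ] sMZ.
have := m2 Y Z sYG sZG sMZ; rewrite defG (setIidPr sZG) => defZ.
have /maximal_eqP[_ /(_ (Y :&: Z)%G)[||/= eqYZ|/= eqYZ]] :
  maximal_eq (M :&: Y) Y by rewrite /maximal_eq maxMY orbT.
- by rewrite /= setIC setIS.
- exact: subsetIl.
- by rewrite -defZ eqYZ; apply/joing_idPl/subsetIl.
- by case/negP: nsGZ; rewrite -defZ eqYZ defG.
Qed.

Lemma modular_capl G M H : modular M G -> H \subset G -> modular (M :&: H) H.
Proof.
move=> /modularP[sMG m1 m2] sHG; apply/modularP; split; first exact: subsetIr.
  move=> X Z sXZ sZH; have sZG := subset_trans sZH sHG.
  rewrite -setIA (setIidPr sZH).
  apply/eqP; rewrite eqEsubset; apply/andP; split.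
    rewrite subsetI join_subG sXZ subsetIr !andbT genS // setUS //.
    by rewrite subsetI subsetIl subIset // sZH orbT.
  by rewrite (m1 X Z) // setSI // genS // setUS // subsetIl.
move=> Y Z sYH sZH sMHZ.
have sYG := subset_trans sYH sHG; have sZG := subset_trans sZH sHG.
(* [Z] need not contain [M], so the second law of [M] is used for [M <*> Z]; by [eq3] this meets [H]
   in [Z] only. *)
have defMH : M :&: H = M :&: Z.
  by apply/eqP; rewrite eqEsubset subsetI subsetIl sMHZ setIS.
have sYZZ: Y :&: Z \subset Z by apply: subsetIr.
have eq1 := m1 Y H sYH sHG; have eq2 := m1 (Y :&: Z)%G Z sYZZ sZG.
have eq3 := m1 Z H sZH sHG.
have sMZG : M <*> Z \subset G by rewrite join_subG sMG.
have eqYZ : Y :&: (M <*> Z) = Y :&: Z.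
  rewrite joingC -{1}(setIidPl sYH) -setIA (setIC H) -eq3.
  by rewrite (joing_idPl sMHZ).
have := m2 Y (M <*> Z)%G sYG sMZG (joing_subl _ _); rewrite eqYZ => eq4.
rewrite /= [LHS]joingC [in LHS]defMH eq2 joingC eq4 -setIA.
rewrite (setIidPr (joing_subr M Z)) (joingC (M :&: H)) eq1 -setIA (setIidPr sZH).
by rewrite joingC.
Qed.

Lemma modular_quotient_lift G M N :
  N <| G -> N \subset M -> M \subset G -> modular (M / N) (G / N) -> modular M G.
Proof.
move=> /andP[sNG nNG] sNM sMG /modularP[_ m1 m2].
have nN K : K \subset G -> K \subset 'N(N) by move/subset_trans->.
apply/modularP; split=> //.
  move=> X Z sXZ sZG; have sXG := subset_trans sXZ sZG.
  have sMZG : M :&: Z \subset G by rewrite subIset ?sMG.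
  have := m1 (X / N)%G (Z / N)%G (quotientS N sXZ) (quotientS N sZG).
  rewrite /= -quotientGI // -!quotientY ?nN // => eqN.
  (* [X] need not contain [N], so the quotient gives the inclusion only up to a factor [N], which
     Dedekind's law in [Z] reduces to [N :&: Z], a part of [M :&: Z]. *)
  have : X <*> M :&: Z \subset N * (X <*> (M :&: Z)).
    rewrite -quotientSK ?nN 1?subIset ?sZG ?orbT // eqN.
    by rewrite quotientI.
  move=> sub1.
  apply/eqP; rewrite eqEsubset; apply/andP; split.
    rewrite subsetI genS ?setUS ?subsetIl //= join_subG sXZ subsetIr //.
  apply: subset_trans (_ : (N * (X <*> (M :&: Z))) :&: Z \subset _).
    by rewrite subsetI sub1 subsetIr.
  rewrite setIC -group_modr ?join_subG ?sXZ ?subsetIr // mul_subG //.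
  by rewrite (subset_trans _ (joing_subr _ _)) // setIC setSI.
move=> Y Z sYG sZG sMZ; have sNZ := subset_trans sNM sMZ.
have := m2 (Y / N)%G (Z / N)%G (quotientS N sYG) (quotientS N sZG) (quotientS N sMZ).
have sYZG : Y :&: Z \subset G by rewrite subIset ?sYG.
have sMYG : M <*> Y \subset G by rewrite join_subG sMG.
rewrite /= -quotientIG // -!quotientY ?nN // -quotientIG //.
apply: quotient_inj; rewrite /normal.
  by rewrite nN ?join_subG ?sMG // (subset_trans sNM) ?joing_subl.
by rewrite subsetI sNZ (subset_trans sNM) ?joing_subl // nN // subIset ?sMYG.
Qed.

Lemma modular_morphim G (rT : finGroupType) (D : {group gT})
    (f : {morphism D >-> rT}) M :
  G \subset D -> modular M G -> modular (f @* M) (f @* G).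
Proof.
move=> sGD /modularP[sMG m1 m2].
(* Images do not commute with intersections in general, but they do when one side is a full preimage
   in [G]. *)
pose pre (X : {group rT}) := (G :&: f @*^-1 X)%G.
have preG (X : {group rT}) : pre X \subset G := subsetIl _ _.
have imI (A : {set gT}) (X : {group rT}) : A \subset G -> f @* (A :&: pre X) = f @* A :&: X.
  by move=> sAG; rewrite /= setIA (setIidPl sAG) morphim_setIpre.
have impre (X : {group rT}) : X \subset f @* G -> f @* (pre X) = X.
  by move=> sXG; rewrite morphim_setIpre (setIidPr sXG).
have subD (A : {set gT}) : A \subset G -> A \subset D by move/subset_trans->.
apply/modularP; split; first exact: morphimS.
  move=> X Z sXZ sZG; have sXG := subset_trans sXZ sZG.
  have sXZ' : pre X \subset pre Z by rewrite setIS ?morphpreS.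
  have := congr1 (fun A => f @* A) (m1 _ _ sXZ' (preG Z)).
  rewrite /= morphimY ?subD ?preG 1?subIset ?sMG //.
  by rewrite !imI ?join_subG ?preG // morphimY ?subD ?preG // impre.
move=> Y Z sYG sZG sMZ.
have sMZ' : M \subset pre Z by rewrite subsetI sMG -sub_morphim_pre ?subD.
have := congr1 (fun A => f @* A) (m2 (pre Y) _ (preG _) (preG Z) sMZ').
rewrite /= morphimY ?subD 1?subIset ?preG //.
by rewrite !imI ?join_subG ?preG ?sMG // morphimY ?subD ?preG // impre.
Qed.

Lemma modular_quotient G M N :
  G \subset 'N(N) -> modular M G -> modular (M / N) (G / N).
Proof. by move=> nNG; apply: modular_morphim. Qed.

End Modular.

Lemma modularJ (gT : finGroupType) (M G : {group gT}) x :
  modular M G -> modular (M :^ x) (G :^ x).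
Proof.
by move=> modM; have := modular_morphim (conjgm [set: gT] x) (subsetT G) modM;
  rewrite !morphim_conj !setTI.
Qed.

(** * Calculus of submodular chains *)

Section Submodular.

Variable gT : finGroupType.
Implicit Types G H K M N X Y Z : {group gT}.

Lemma submodular_refl G : submodular G G.
Proof. by exists [::]. Qed.

Lemma submodular_step H M G : modular H M -> submodular M G -> submodular H G.
Proof. by move=> modH [s pMs lastG]; exists (M :: s); rewrite //= modH. Qed.

Lemma submodular_elim (P : {group gT} -> {group gT} -> Prop) :
    (forall G, P G G) ->
    (forall H M G, modular H M -> submodular M G -> P M G -> P H G) ->
  forall H G, submodular H G -> P H G.
Proof.
move=> P1 PM H G [s]; elim: s H => [|M s IHs] H /=; first by move=> _ <-.
case/andP=> modH pMs lastG; apply: (PM H M) => //; first by exists s.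
exact: IHs.
Qed.

Lemma modular_submodular M G : modular M G -> submodular M G.
Proof. by move=> modM; apply: submodular_step modM (submodular_refl G). Qed.

Lemma submodular_sub H G : submodular H G -> H \subset G.
Proof.
move: H G; apply: submodular_elim => // H M G /modular_sub sHM _.
exact: subset_trans.
Qed.

Lemma submodular_trans M H G :
  submodular H M -> submodular M G -> submodular H G.
Proof.
move=> subHM; move: H M subHM G.
by apply: submodular_elim => // H M L modH _ IH G /IH; apply: submodular_step.
Qed.

(** Exposes the top proper step of the chain, where [submodular_elim] peels off the bottom one. *)
Lemma submodular_proper H G : submodular H G ->
  H :=: G \/ exists M : {group gT},
    [/\ submodular H M, modular M G & M \proper G].
Proof.
move: H G; apply: submodular_elim => [G|H M G modH subM]; first by left.
have [-> // | neHM [/val_inj defM | [L [subL modL prL]]]] := eqVneq H M.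
  right; exists H; rewrite -defM; split=> //; first exact: submodular_refl.
  by rewrite properEneq neHM modular_sub.
by right; exists L; split=> //; apply: submodular_step subL.
Qed.

Lemma submodular_capl H G K :
  submodular H G -> K \subset G -> submodular (H :&: K)%G K.
Proof.
move=> subH; move: H G subH K.
apply: submodular_elim => [G K sKG | H M G modH _ IH K sKG].
  rewrite (_ : (G :&: K)%G = K); first exact: submodular_refl.
  by apply: val_inj; apply/setIidPr.
apply: submodular_step (IH K sKG) => /=.
have := modular_capl modH (subsetIl M K).
by rewrite setIA (setIidPl (modular_sub modH)).
Qed.

Lemma submodular_subl H G K :
  submodular H G -> H \subset K -> K \subset G -> submodular H K.
Proof.
move=> subH sHK sKG; rewrite -(_ : (H :&: K)%G = H).
  exact: submodular_capl subH sKG.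
by apply: val_inj; apply/setIidPl.
Qed.

Lemma submodular_capI H K G :
  submodular H G -> submodular K G -> submodular (H :&: K)%G G.
Proof.
move=> subH subK; apply: (submodular_trans _ subK).
exact: submodular_capl subH (submodular_sub subK).
Qed.

End Submodular.

Lemma submodular_morphim (gT rT : finGroupType) (D : {group gT})
    (f : {morphism D >-> rT}) (H G : {group gT}) :
  G \subset D -> submodular H G -> submodular (f @* H)%G (f @* G)%G.
Proof.
move=> sGD subH; move: H G subH sGD; apply: submodular_elim => [G | H M G].
  by move=> _; apply: submodular_refl.
move=> modH subM IH sGD; apply: submodular_step (IH sGD).
exact: modular_morphim (subset_trans (submodular_sub subM) sGD) modH.
Qed.

Section SubmodularQuotient.

Variables (gT : finGroupType) (N : {group gT}).
Implicit Types G H K M : {group gT}.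

Lemma submodular_quotient_lift G H :
    N <| G -> N \subset H -> H \subset G -> submodular (H / N)%G (G / N)%G ->
  submodular H G.
Proof.
have [n] := ubnP #|G|; elim: n G => // n IHn G leGn nsNG sNH sHG.
have nNG := normal_norm nsNG.
have nNH := subset_trans sHG nNG.
case/submodular_proper=> [eqHG | [M' [subHM' modM' prM']]].
  suff -> : H = G by apply: submodular_refl.
  apply: val_inj; apply: (quotient_inj _ nsNG eqHG).
  by rewrite /normal sNH.
have sM'G := proper_sub prM'.
have [M defM sNM sMG] := inv_quotientS nsNG sM'G.
have prMG : M \proper G.
  rewrite properEneq sMG andbT; apply: contraTneq prM' => eqMG.
  by rewrite defM eqMG properxx.
have defM' : M' = (M / N)%G by apply: val_inj.
subst M'; have nsNM := normalS sNM sMG nsNG.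
apply: (@submodular_trans _ M).
  apply: IHn => //; first exact: leq_trans (proper_card prMG) leGn.
  by rewrite -(quotientSGK nNH sNM) (submodular_sub subHM').
by apply: modular_submodular; apply: modular_quotient_lift modM'.
Qed.

End SubmodularQuotient.

(** * The class smU *)

Section SmU.

Variable gT : finGroupType.
Implicit Types G H K M N P Q : {group gT}.

Lemma smU_sub G H : H \subset G -> smU G -> smU H.
Proof.
move=> sHG smG p P p_pr sylP; have [sPH pP _] := and3P sylP.
have [Q sylQ sPQ] := Sylow_superset (subset_trans sPH sHG) pP.
have [sQG pQ _] := and3P sylQ.
rewrite (_ : P = Q :&: H)%G; first exact: submodular_capl (smG p Q p_pr sylQ) sHG.
apply: val_inj; apply/esym/(sub_pHall sylP); rewrite ?subsetIr //.
  exact: pgroupS (subsetIl _ _) pQ.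
by rewrite /= subsetI sPQ.
Qed.

Lemma Sylow_morphim_ex (rT : finGroupType) (D : {group gT})
    (f : {morphism D >-> rT}) p G (Q : {group rT}) :
    G \subset D -> p.-Sylow(f @* G) Q ->
  exists2 P : {group gT}, p.-Sylow(G) P & Q = (f @* P)%G.
Proof.
move=> sGD sylQ; have [P sylP] := Sylow_exists p G.
have sPG := pHall_sub sylP.
have sylfP := morphim_pHall f (subset_trans sPG sGD) sylP.
have [y /morphimP[x Dx Gx ->] defQ] := Sylow_trans sylfP sylQ.
exists (P :^ x)%G; first by rewrite pHallJ.
by apply: val_inj; rewrite /= morphimJ.
Qed.

Lemma smU_morphim (rT : finGroupType) (D : {group gT})
    (f : {morphism D >-> rT}) G :
  G \subset D -> smU G -> smU (f @* G)%G.
Proof.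
move=> sGD smG p Q p_pr /(Sylow_morphim_ex sGD)[P sylP ->].
exact: submodular_morphim sGD (smG p P p_pr sylP).
Qed.

Lemma smU_quotient G N : N <| G -> smU G -> smU (G / N)%G.
Proof. by move=> /normal_norm nNG; apply: smU_morphim. Qed.

Lemma smU_isog (rT : finGroupType) G (H : {group rT}) :
  G \isog H -> smU G -> smU H.
Proof.
case/isogP=> f _ fG smG; rewrite (_ : H = f @* G)%G; last exact: val_inj.
exact: smU_morphim.
Qed.

Lemma smU_quotientP G N :
    N <| G ->
  smU (G / N)%G <-> forall p P,
    prime p -> p.-Sylow(G) P -> submodular (N <*> P)%G G.
Proof.
move=> nsNG; have [sNG nNG] := andP nsNG.
have nNP p P : p.-Sylow(G) P -> P \subset 'N(N).
  by move/pHall_sub/subset_trans->.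
have defPN p P : p.-Sylow(G) P -> (P / N)%G = ((N <*> P) / N)%G.
  by move/nNP=> nNP'; apply: val_inj; rewrite /= quotientYidl.
split=> [smGN p P p_pr sylP | subG p Q p_pr].
  apply: (submodular_quotient_lift nsNG); first exact: joing_subl.
    by rewrite join_subG sNG (pHall_sub sylP).
  rewrite -(defPN _ _ sylP); apply: smGN p_pr _.
  exact: quotient_pHall (nNP _ _ sylP) sylP.
move/(Sylow_morphim_ex nNG)=> [P sylP ->].
rewrite [X in submodular X](defPN _ _ sylP).
exact: submodular_morphim nNG (subG p P p_pr sylP).
Qed.

(** The left side [K] has [p]-groups as images modulo [N1] and [N2], so [N1 :&: N2] has [p]-power
    index in it, while [P] has index prime to [p]. The index of the right side divides both. *)
Lemma Sylow_join_setI p G N1 N2 P :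
    N1 <| G -> N2 <| G -> p.-Sylow(G) P ->
  (N1 <*> P) :&: (N2 <*> P) = (N1 :&: N2) <*> P.
Proof.
move=> nsN1 nsN2 sylP; have [sPG pP _] := and3P sylP.
have [nN1P nN2P] : P \subset 'N(N1) /\ P \subset 'N(N2).
  by rewrite !(subset_trans sPG) ?normal_norm.
pose K := ((N1 <*> P) :&: (N2 <*> P))%G.
have sKG : K \subset G.
  by apply: subset_trans (subsetIl _ _) _; rewrite join_subG normal_sub.
have sPK : P \subset K by rewrite subsetI !joing_subr.
have pKN N : N <| G -> K \subset N <*> P -> p.-group (K / N).
  move=> nsN sKNP; have nNP := subset_trans sPG (normal_norm nsN).
  apply: pgroupS (quotientS N sKNP) _.
  by rewrite /= quotientYidl // quotient_pgroup.
have sNK : N1 :&: N2 \subset K by rewrite setISS ?joing_subl.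
have nKN N : N <| G -> K \subset 'N(N).
  by move/normal_norm; apply: subset_trans.
have pK : p.-nat #|K : N1 :&: N2|.
  have sIK : N1 :&: N2 \subset K :&: N1 by rewrite subsetI sNK subsetIl.
  rewrite -(Lagrange_index (subsetIl K N1) sIK) pnatM; apply/andP; split.
    rewrite indexgI -card_quotient ?nKN //; exact: pKN (subsetIl _ _).
  have -> : #|K :&: N1 : N1 :&: N2| = #|(K :&: N1) / N2|.
    have nN2 : K :&: N1 \subset 'N(N2) by rewrite subIset ?nKN.
    by rewrite card_quotient // -(indexgI (K :&: N1)%G N2) /= -(setIA K) (setIidPr sNK).
  apply: pgroupS (quotientS N2 (subsetIl K N1)) _; exact: pKN (subsetIr _ _).
apply/eqP; rewrite eq_sym eqEcard; apply/andP; split.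
  by rewrite join_subG sNK.
have sNPK : (N1 :&: N2) <*> P \subset K by rewrite join_subG sNK.
rewrite -(Lagrange sNPK) /=.
suff -> : #|K : (N1 :&: N2) <*> P| = 1%N by rewrite muln1.
apply: (@pnat_1 p).
  by apply: pnat_dvd pK; rewrite indexgS // joing_subl.
have := pHall_subl sPK sKG sylP; case/and3P=> _ _; apply: pnat_dvd.
by rewrite indexgS // joing_subr.
Qed.

Lemma smU_quotientI G N1 N2 :
    N1 <| G -> N2 <| G -> smU (G / N1)%G -> smU (G / N2)%G ->
  smU (G / (N1 :&: N2))%G.
Proof.
move=> nsN1 nsN2 /(smU_quotientP nsN1) sub1 /(smU_quotientP nsN2) sub2.
have nsN : N1 :&: N2 <| G by rewrite normalI.
apply/(smU_quotientP nsN) => p P p_pr sylP.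
rewrite (_ : _ <*> P = (N1 <*> P) :&: (N2 <*> P))%G.
  by apply: submodular_capI; [apply: sub1 sylP | apply: sub2 sylP].
by apply: val_inj; rewrite /= (Sylow_join_setI nsN1 nsN2 sylP).
Qed.

End SmU.

(** [G / H1] and [G / H2] are copies of [H2] and [H1], so this is a subdirect product. *)
Lemma smU_dprod (gT : finGroupType) (G H1 H2 : {group gT}) :
  H1 \x H2 = G -> smU H1 -> smU H2 -> smU G.
Proof.
move=> defG sm1 sm2; have [_ _ _ tiH] := dprodP defG.
have [ns1 ns2] := dprod_normal2 defG.
have iso2 := sdprod_isog (dprodWsd defG).
have iso1 := sdprod_isog (dprodWsdC defG).
have := smU_quotientI ns1 ns2 (smU_isog iso2 sm2) (smU_isog iso1 sm1).
apply: smU_isog; rewrite isog_sym /= tiH; exact: quotient1_isog.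
Qed.

(** * Coprime action and submodularity *)

(* The smallest normal subgroup of G with abelian quotient of exponent dividing
   n. *)
Definition exp_residual (gT : finGroupType) n (G : {set gT}) :=
  G^`(1) <*> [set a ^+ n | a in G].

Section ExpResidual.

Variables (gT : finGroupType) (n : nat).
Implicit Types G H K P R : {group gT}.

Canonical exp_residual_group (G : {set gT}) :=
  Eval hnf in [group of exp_residual n G].

Lemma exp_residual_sub G : exp_residual n G \subset G.
Proof.
rewrite join_subG der_sub; apply/subsetP=> _ /imsetP[a Ga ->].
exact: groupX.
Qed.

Lemma exp_residual_subP G H :
  reflect (G^`(1) \subset H /\ {in G, forall a, a ^+ n \in H})
          (exp_residual n G \subset H).
Proof.
rewrite join_subG; apply: (iffP andP) => -[sG'H sGnH]; split=> //.
  by move=> a Ga; apply: (subsetP sGnH); apply: imset_f.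
by apply/subsetP=> _ /imsetP[a Ga ->]; apply: sGnH.
Qed.

Lemma exp_residual_quotient G K :
  G \subset 'N(K) -> exp_residual n G / K = exp_residual n (G / K).
Proof.
move=> nKG; have sGnN : [set a ^+ n | a in G] \subset 'N(K).
  by apply/subsetP=> _ /imsetP[a Ga ->]; rewrite groupX // (subsetP nKG).
rewrite quotientY ?quotient_der ?(subset_trans (der_sub 1 G)) //.
congr (_ <*> _); apply/setP=> x; apply/morphimP/imsetP.
  case=> _ _ /imsetP[a Ga ->] ->; exists (coset K a); first exact: mem_quotient.
  by rewrite morphX ?(subsetP nKG).
case=> _ /morphimP[a Na Ga ->] ->; exists (a ^+ n); rewrite ?groupX ?morphX //.
exact: imset_f.
Qed.

End ExpResidual.

(** [Aut R] is abelian of order [r.-1]: commutators act trivially, and the exponent [n] improves to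
    its gcd with [r.-1]. *)
Lemma exp_residual_sub_cent_prime (gT : finGroupType) n (G R : {group gT}) r :
    prime r -> #|R| = r -> G \subset 'N(R) ->
    (forall a, a \in G -> a ^+ n \in 'C(R)) ->
  exp_residual (gcdn n r.-1) G \subset 'C(R).
Proof.
move=> r_pr oR nRG Gn; have cycR : cyclic R by rewrite prime_cyclic ?oR.
have abA := Aut_cyclic_abelian cycR.
apply/exp_residual_subP; split=> [|a Ga].
  rewrite /= -ker_conj_aut ker_trivg_morphim (subset_trans (der_sub 1 G)) //=.
  by rewrite morphim_der // (derG1P _) ?(abelianS (Aut_conj_aut R G)).
have Na : a \in 'N(R) := subsetP nRG a Ga.
have /kerP : a ^+ n \in 'ker (conj_aut R) by rewrite ker_conj_aut Gn.
rewrite groupX // => /(_ isT); rewrite morphX // => an1.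
rewrite /= -ker_conj_aut; apply/kerP; first by rewrite groupX.
rewrite morphX //; apply/eqP; rewrite -order_dvdn dvdn_gcd !order_dvdn an1 eqxx.
rewrite /= -order_dvdn -(totient_prime r_pr) -oR -card_Aut_cyclic //.
by apply: order_dvdG; apply: (subsetP (Aut_conj_aut R G)); apply: mem_morphim.
Qed.

Section ModularComplement.

Variables (gT : finGroupType) (p r : nat).
Hypotheses (p_pr : prime p) (r_pr : prime r) (neq_pr : p != r).
Implicit Types M P R : {group gT}.

Lemma pgroup_coprime P R : p.-group P -> r.-group R -> coprime #|R| #|P|.
Proof.
move=> pP rR; apply: (p'nat_coprime (pi := p)) => //.
by apply: sub_pgroup rR => q; rewrite !inE => /eqP->; rewrite eq_sym.
Qed.

(** If [R] does not normalise [P], some generator [x] of [R] has [P :&: P :^ x] of index [p] in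
    [P :^ x], as [P] is modular and maximal. So [(a ^+ p) ^ x] is in [P], and [[~ a ^+ p, x]] is in
    [P :&: R = 1]. *)
Lemma modular_expg_cent P R :
    p.-group P -> #|R| = r -> P \subset 'N(R) -> modular P (R <*> P) ->
  {in P, forall a, a ^+ p \in 'C(R)}.
Proof.
move=> pP oR nRP modP a Pa; have rR : r.-group R by rewrite /pgroup oR pnat_id.
have coRP := pgroup_coprime pP rR; have tiRP := coprime_TIg coRP.
have [sRN | /subsetPn[x Rx nNx]] := boolP (R \subset 'N(P)).
  apply: (subsetP _ _ (groupX p Pa)); rewrite centsC; apply/commG1P/trivgP.
  rewrite -tiRP subsetI commg_subl commg_subr; exact/andP.
have oRP : #|R <*> P : P| = r.
  apply/eqP; rewrite -(eqn_pmul2l (cardG_gt0 P)) Lagrange ?joing_subr //.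
  by rewrite /= norm_joinEr // coprime_cardMg // oR mulnC.
have maxP : maximal P (R <*> P) by apply: p_index_maximal; rewrite ?joing_subr ?oRP.
have sPxRP : P :^ x \subset R <*> P.
  by rewrite -(conjGid (subsetP (joing_subl R P) x Rx)) conjSg joing_subr.
have maxPPx : maximal (P :&: P :^ x) (P :^ x).
  apply: modular_maximal_cap modP maxP sPxRP _; apply: contra nNx => sPxP.
  by apply/normP/eqP; rewrite eqEcard sPxP cardJg /=.
have pPx : p.-group (P :^ x) by rewrite pgroupJ.
have nsPx := p_maximal_normal pPx maxPPx.
have apx : (a ^+ p) ^ x \in P.
  have ax : a ^ x \in P :^ x by rewrite memJ_conjg.
  have Nax : a ^ x \in 'N(P :&: P :^ x) := subsetP (normal_norm nsPx) _ ax.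
  have: (a ^ x) ^+ p \in P :&: P :^ x; last by rewrite conjXg => /setIP[].
  apply: coset_idr; first exact: groupX.
  rewrite morphX // -(p_maximal_index pPx maxPPx) -card_quotient ?normal_norm //.
  by rewrite expg_cardG // mem_quotient.
have : [~ a ^+ p, x] = 1.
  apply/set1P; rewrite -[[set 1]]tiRP inE {1}commgEr commgEl.
  rewrite groupMr // memJ_norm ?groupV ?Rx; last by rewrite groupX // (subsetP nRP).
  by rewrite groupMl // groupV groupX.
move=> /eqP/commgP cax; have ntx : x != 1 by apply: contraNneq nNx => ->; apply: group1.
have R_pr : prime #|R| by rewrite oR.
rewrite (nt_gen_prime R_pr (x := x)) ?inE ?ntx //.
by rewrite cent_cycle; apply/cent1P.
Qed.

(* Modularity of P forces every cyclic subgroup of R to be P-invariant. *)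
Lemma modular_exp_residual_cent P R :
    p.-group P -> r.-abelem R -> P \subset 'N(R) -> modular P (R <*> P) ->
  exp_residual (gcdn p r.-1) P \subset 'C(R).
Proof.
move=> pP abelR nRP modP; have rR := abelem_pgroup abelR.
have tiRP := coprime_TIg (pgroup_coprime pP rR).
have [_ m1 _] := modularP _ _ modP.
rewrite centsC; apply/subsetP=> x Rx; rewrite -cycle_subG centsC.
have [-> | ntx] := eqVneq x 1; first by rewrite cycle1 cents1.
have sxR : <[x]> \subset R by rewrite cycle_subG.
have nxP : P \subset 'N(<[x]>).
  have := m1 <[x]>%G R sxR (joing_subl _ _); rewrite setIC tiRP joingG1 => ->.
  by rewrite normsI // (subset_trans (joing_subr _ _) (normG _)).
apply: exp_residual_sub_cent_prime (abelem_order_p abelR Rx ntx) _ _ => //.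
apply: modular_expg_cent (abelem_order_p abelR Rx ntx) _ _ => //.
have := modular_capl modP (genS (setSU P sxR)).
by rewrite (setIidPl (joing_subr _ _)).
Qed.

End ModularComplement.

(* Coprime action lifts fixed points modulo S <*> 'Phi(R). *)
Lemma coprime_cent_join_Phi (gT : finGroupType) (r : nat) (A R S : {group gT}) :
    r.-group R -> coprime #|R| #|A| -> A \subset 'N(R) -> S \subset R ->
    A \subset 'C(S) -> [~: A, R] \subset S <*> 'Phi(R) ->
  A \subset 'C(R).
Proof.
move=> rR coRA nRA sSR cAS sARB; pose B := (S <*> 'Phi(R))%G.
have sBR : B \subset R by rewrite join_subG sSR Phi_sub.
have nBR : R \subset 'N(B).
  rewrite normal_norm // sub_der1_normal // (subset_trans _ (joing_subr _ _)) //.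
  by rewrite (Phi_joing rR) joing_subl.
have nBA : A \subset 'N(B).
  by rewrite normsY ?(cents_norm cAS) // (char_norm_trans (Phi_char R)).
have defR : 'Phi(R) <*> 'C_R(A) = R.
  apply/eqP; rewrite eqEsubset join_subG Phi_sub subsetIl /=.
  have : R \subset B * 'C_R(A).
    rewrite -quotientSK // coprime_norm_quotient_cent //.
    - by rewrite subsetI subxx centsC quotient_cents2.
    - exact: coprimeSg sBR coRA.
    exact: pgroup_sol (pgroupS sBR rR).
  move/subset_trans; apply; rewrite mul_subG ?joing_subr // join_subG joing_subl.
  by rewrite andbT (subset_trans _ (joing_subr _ _)) // subsetI sSR centsC.
have := Phi_nongen defR; rewrite genGid => {}defR.
by rewrite centsC -{1}defR subsetIr.
Qed.

(** Induction on [#|R|]: the top proper term [M] of the chain is [S <*> P] with [S = M :&: R], and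
    [E] centralises [S]. Modulo [S <*> 'Phi(R)] that term becomes the image of [P], which is the
    elementary abelian case. *)
Lemma submodular_exp_residual_cent (gT : finGroupType) p r (P R : {group gT}) :
    prime p -> prime r -> p != r ->
    p.-group P -> r.-group R -> P \subset 'N(R) -> submodular P (R <*> P)%G ->
  exp_residual (gcdn p r.-1) P \subset 'C(R).
Proof.
move=> p_pr r_pr neq_pr; have [n] := ubnP #|R|; elim: n R => // n IHn R leRn pP rR nRP subP.
pose E := exp_residual_group (gcdn p r.-1) P.
rewrite -[exp_residual _ P]/(gval E); have sEP : E \subset P := exp_residual_sub _ P.
have coRP := pgroup_coprime neq_pr pP rR; have tiRP := coprime_TIg coRP.
have nRE := subset_trans sEP nRP; have coRE := coprimegS sEP coRP.
case/submodular_proper: subP => [defP | [M [subPM modM prM]]].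
  suff -> : R :=: 1 by apply: cents1.
  by rewrite -tiRP; apply/esym/setIidPl; rewrite defP joing_subl.
have sPM := submodular_sub subPM; have sMRP := proper_sub prM.
pose S := (M :&: R)%G; have sSR : S \subset R := subsetIr _ _.
have nSP : P \subset 'N(S) by rewrite normsI // (subset_trans sPM) ?normG.
have defM : M = (S <*> P)%G.
  apply: val_inj; rewrite /= norm_joinEr //= group_modr // -norm_joinEr //.
  exact/esym/setIidPl.
have prSR : S \proper R.
  rewrite properEneq sSR andbT; apply: contraTneq prM => eqSR.
  by rewrite defM /= eqSR properxx.
have cSE : E \subset 'C(S).
  apply: IHn => //; first exact: leq_trans (proper_card prSR) leRn.
    exact: pgroupS rR.
  by rewrite -defM.
pose B := (S <*> 'Phi(R))%G.
have nsBR : B <| R.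
  rewrite sub_der1_normal ?join_subG ?sSR ?Phi_sub //.
  rewrite (subset_trans _ (joing_subr _ _)) //.
  by rewrite (Phi_joing rR) joing_subl.
have sBR := normal_sub nsBR; have nBR := normal_norm nsBR.
have nBP : P \subset 'N(B) by rewrite normsY // (char_norm_trans (Phi_char R)).
have nBRP : R <*> P \subset 'N(B) by rewrite join_subG nBR.
have abelRB : r.-abelem (R / B).
  rewrite -trivg_Phi ?quotient_pgroup // -(quotient_Phi rR) //.
  by rewrite quotientS1 // joing_subr.
have cRB : E / B \subset 'C(R / B).
  rewrite [E / B]exp_residual_quotient //.
  apply: modular_exp_residual_cent; rewrite ?quotient_pgroup ?quotient_norms //.
  have := modular_quotient nBRP modM.
  rewrite {1}defM /= !quotientY ?(subset_trans sSR) //.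
  by rewrite (quotientS1 (joing_subl S _)) joing1G.
apply: (coprime_cent_join_Phi rR coRE nRE sSR cSE).
by rewrite -quotient_cents2 // (subset_trans sEP).
Qed.

(** * The Sylow subgroup for the largest prime *)

Section BurnsideTransfer.

Variables (gT : finGroupType) (p : nat) (G P : {group gT}).
Hypotheses (sylP : p.-Sylow(G) P) (cNP : 'N_G(P) \subset 'C(P)).

Lemma central_Sylow_abelian : abelian P.
Proof.
by apply: subset_trans cNP; rewrite subsetI (pHall_sub sylP) normG.
Qed.

(** [P] and [P :^ g] are Sylow in the centraliser of [x ^ g], so conjugate by some [c] in it;
    [g * c] normalises [P], hence centralises it, and [c] fixes [x ^ g]. *)
Lemma central_Sylow_fusion x g :
  x \in P -> g \in G -> x ^ g \in P -> x ^ g = x.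
Proof.
move=> Px Gg Pxg; have abP := central_Sylow_abelian.
have sPG := pHall_sub sylP.
pose C := 'C_G[x ^ g]%G.
have sPC : P \subset C.
  by rewrite subsetI sPG sub_cent1 (subsetP abP).
have sPgC : P :^ g \subset C.
  rewrite subsetI -{1}(conjGid Gg) conjSg sPG sub_cent1 /= centJ memJ_conjg.
  exact: subsetP abP x Px.
have sCG : C \subset G by apply: subsetIl.
have sylPC := pHall_subl sPC sCG sylP.
have sylPgC : p.-Sylow(C) (P :^ g).
  by apply: (pHall_subl sPgC sCG); rewrite pHallJ.
have [c Cc defP] := Sylow_trans sylPgC sylPC.
have [Gc cxg] := setIP Cc.
have Ngc : g * c \in 'N_G(P).
  by rewrite !inE groupM //= conjsgM -defP subxx.
have : x ^ (g * c) = x.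
  by rewrite conjgE -(centP (subsetP cNP _ Ngc) x Px) mulKg.
by rewrite conjgM [LHS]conjgE -(cent1P cxg) mulKg.
Qed.

(** [K] is the kernel of the transfer into [P]. On [P] the transfer is raising to the power
    [#|G : P|], injective since this index is prime to [#|P|]. *)
Lemma Burnside_transfer :
  exists2 K : {group gT}, K <| G & K :&: P = 1 /\ abelian (G / K).
Proof.
have abP := central_Sylow_abelian; have sPG := pHall_sub sylP.
have abA : abelian (idm P @* P) by rewrite morphim_idm.
pose f := transfer_morphism G abA.
exists ('ker f)%G; first exact: ker_normal.
split.
  apply/trivgP/subsetP=> g /setIP[/setIP[Gg]].
  rewrite !inE /= => f1 Pg.
  pose X := transversal (rcosets P G :* <[g]>) G.
  have trX : is_transversal X (rcosets P G :* <[g]>) G.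
    by apply: transversalP; apply: rcosets_cycle_partition.
  have Ag : g \in idm P @* P by rewrite morphim_idm.
  move: f1; rewrite (transfer_cycle_expansion sPG abA Gg trX).
  (* By fusion each factor of the cycle expansion is a power of [g]; the exponents are cycle lengths
     on cosets and add up to [#|G : P|]. *)
  rewrite (eq_bigr (fun x => FiniteModule.fmod abA g *+ #|<[g]> : P :* x|)%R); last first.
    move=> x Xx; have Gx := subsetP (transversal_sub trX) x Xx.
    have Pgx : (g ^+ #|<[g]> : P :* x|) ^ x^-1 \in P.
      have := mulg_exp_card_rcosets P g x.
      by rewrite mem_rcoset conjgE invgK mulgA.
    rewrite central_Sylow_fusion ?groupX ?groupV //.
    rewrite -[LHS]/(FiniteModule.fmod abA (g ^+ _)).
    by rewrite FiniteModule.fmodX.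
  rewrite GRing.sumrMnr (sum_index_rcosets_cycle sPG Gg trX) -FiniteModule.fmodX //.
  move/eqP/(congr1 (@FiniteModule.fmval _ _ _)).
  rewrite FiniteModule.fmodK ?groupX // => gn1.
  have /andP[_ coP] := pHall_Hall sylP.
  have -> : g = 1; last by rewrite eqxx.
  by rewrite -(expgK coP Pg) gn1 /= expg1n.
by rewrite (isog_abelian (first_isog f)); apply: FinRing.zmod_abelian.
Qed.

End BurnsideTransfer.

Lemma normal_quotient_join (gT : finGroupType) (G N R : {group gT}) :
  N <| G -> R \subset G -> (R / N <| G / N) = (N <*> R <| G).
Proof.
move=> nsNG sRG; have [sNG nNG] := andP nsNG; have nNR := subset_trans sRG nNG.
rewrite -(quotientYidl nNR) -cosetpre_normal !quotientGK //.
by rewrite /normal joing_subl join_subG normG.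
Qed.

Section SylowTower.

Variable gT : finGroupType.
Implicit Types (p q r : nat) (G H K N P Q R : {group gT}).

Lemma exp_residual1 G : exp_residual 1 G = G.
Proof.
apply/eqP; rewrite eqEsubset exp_residual_sub /=.
apply: subset_trans (joing_subr _ _); apply/subsetP=> a Ga.
by rewrite -[a]expg1; apply: imset_f.
Qed.

Lemma smU_exp_residual_cent p r G P R :
    prime p -> prime r -> p != r -> smU G -> p.-Sylow(G) P ->
    R \subset G -> r.-group R -> P \subset 'N(R) ->
  exp_residual (gcdn p r.-1) P \subset 'C(R).
Proof.
move=> p_pr r_pr neq_pr smG sylP sRG rR nRP; have [sPG pP _] := and3P sylP.
apply: submodular_exp_residual_cent => //.
by apply: submodular_subl (smG p P p_pr sylP) _ _; rewrite ?joing_subr // join_subG sRG.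
Qed.

(** Since [0 < r.-1 < p], the gcd is 1 and the residual is all of [P]. *)
Lemma smU_cent_gt p r G P R :
    prime p -> prime r -> r < p -> smU G -> p.-Sylow(G) P ->
    R \subset G -> r.-group R -> P \subset 'N(R) ->
  P \subset 'C(R).
Proof.
move=> p_pr r_pr lt_rp smG sylP sRG rR nRP.
have neq_pr : p != r by rewrite neq_ltn lt_rp orbT.
have := smU_exp_residual_cent p_pr r_pr neq_pr smG sylP sRG rR nRP.
suff -> : gcdn p r.-1 = 1%N by rewrite exp_residual1.
apply/eqP; rewrite -[_ == _]/(coprime p r.-1) prime_coprime // gtnNdvd //.
  by rewrite -subn1 subn_gt0 prime_gt1.
exact: leq_ltn_trans (leq_pred r) lt_rp.
Qed.

Lemma sub_of_Sylows G H :
    (forall q, prime q -> exists2 Q : {group gT}, q.-Sylow(G) Q & Q \subset H) ->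
  G \subset H.
Proof.
move=> sylH; have /eqP <- : G :&: H == G; last exact: subsetIr.
rewrite eqEcard subsetIl dvdn_leq //; apply/dvdn_partP=> // q.
rewrite mem_primes => /and3P[q_pr _ _]; have [Q sylQ sQH] := sylH q q_pr.
by rewrite -(card_Hall sylQ) cardSg // subsetI (pHall_sub sylQ).
Qed.

End SylowTower.

(** * Minimal counterexample to normality of the Sylow subgroup *)

Section MinimalCounterexample.

Variables (gT : finGroupType) (p : nat) (G P : {group gT}).
Implicit Types (q : nat) (x y : gT) (H K N Q : {group gT}).
Hypotheses (p_pr : prime p) (smG : smU G) (sylP : p.-Sylow(G) P).
Hypothesis p_max : forall q, prime q -> q %| #|G| -> q <= p.
Hypothesis IHsub : forall H : {group gT}, P \subset H -> H \proper G -> P <| H.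
Hypothesis IHquo : forall N : {group gT}, N <| G -> N :!=: 1 -> P / N <| G / N.
Hypothesis not_nPG : ~~ (P <| G).

Let sPG : P \subset G := pHall_sub sylP.
Let pP : p.-group P := pHall_pgroup sylP.

Lemma mincx_pgroup_sub H Q :
  P <| H -> H \subset G -> Q \subset H -> p.-group Q -> Q \subset P.
Proof.
move=> nPH sHG sQH pQ; have sylPH := pHall_subl (normal_sub nPH) sHG sylP.
by rewrite (sub_normal_Hall sylPH).
Qed.

(** Take the top proper term [M] of the chain. A [p]-subgroup outside [M] generates [G] with [M], by
    [IHsub]; one that is minimal, [Y], has [M :&: Y] maximal in [Y], so [M] is maximal by
    [modular_maximal]. It normalises [P], and ['N_G(P)] is proper. *)
Lemma mincx_modular : exists M : {group gT},
  [/\ modular M G, maximal M G & M :=: 'N_G(P)].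
Proof.
case/submodular_proper: (smG p_pr sylP) => [eqPG | [M [subPM modM prM]]].
  by case/negP: not_nPG; rewrite eqPG normal_refl.
have sPM := submodular_sub subPM; have sMG := proper_sub prM.
have nsPM := IHsub sPM prM.
have /subsetPn[x Gx nPx] : ~~ (G \subset 'N(P)).
  by apply: contra not_nPG; rewrite /normal sPG.
have genM (Y : {group gT}) :
    Y \subset G -> p.-group Y -> ~~ (Y \subset M) -> M <*> Y = G.
  move=> sYG pY nYM; apply/eqP; apply: contraNT nYM => neMY.
  have prMY : M <*> Y \proper G by rewrite properEneq neMY join_subG sMG.
  apply: subset_trans (normal_sub nsPM).
  apply: mincx_pgroup_sub (proper_sub prMY) (joing_subr _ _) pY.
  by apply: IHsub prMY; apply: subset_trans sPM (joing_subl _ _).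
have nPxM : ~~ (P :^ x \subset M).
  apply: contra nPx => sPxM; apply/normP/eqP; rewrite eqEcard cardJg leqnn andbT.
  by apply: mincx_pgroup_sub nsPM sMG sPxM _; rewrite pgroupJ.
have [Y minY sYPx] : {Y : {group gT} | [min Y | ~~ (Y \subset M)] & Y \subset P :^ x}.
  exact: (@mingroup_exists _ (fun Y => ~~ (Y \subset M)) (P :^ x)%G).
have [nYM minYM] := mingroupP minY.
have sYG : Y \subset G.
  by apply: subset_trans sYPx _; rewrite -(conjGid Gx) conjSg.
have pY : p.-group Y by apply: pgroupS sYPx _; rewrite pgroupJ.
have maxMY : maximal (M :&: Y) Y.
  apply/maxgroupP; split; first by rewrite /= properE subsetIr subsetI subxx andbT.
  move=> Z /= prZ sMYZ; apply/eqP; rewrite eqEsubset sMYZ andbT subsetI (proper_sub prZ) andbT.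
  apply: contraLR prZ => nZM; rewrite properE.
  by apply/negP=> /andP[sZY /negP[]]; rewrite (minYM Z).
have maxM := modular_maximal modM sYG maxMY (genM Y sYG pY nYM).
exists M; split=> //; apply/eqP; rewrite eqEsubset subsetI sMG normal_norm //=.
have /maximal_eqP[_ /(_ 'N_G(P)%G)[||/= -> //|/= defG]] : maximal_eq M G.
- by rewrite /maximal_eq maxM orbT.
- by rewrite subsetI sMG normal_norm.
- exact: subsetIl.
- by case/negP: nPx; have /setIP[] : x \in 'N_G(P) by rewrite defG.
Qed.

Variable M : {group gT}.
Hypotheses (modM : modular M G) (maxM : maximal M G) (defM : M :=: 'N_G(P)).

Let sMG : M \subset G. Proof. exact: modular_sub modM. Qed.
Let nsPM : P <| M.
Proof. by rewrite defM /normal subsetI sPG normG subsetIr. Qed.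
Let mem_M x : x \in G -> (x \in M) = (P :^ x \subset P).
Proof. by move=> Gx; rewrite defM !inE Gx. Qed.

(** [D = M :&: P :^ x] lies in [P] and has index [p] in both [P] and [P :^ x], so it is normalised
    by both, and they generate [G]. If [D] were nontrivial, [IHquo] would make [P] normal. *)
Lemma mincx_P x : x \in G -> x \notin M -> #|P| = p /\ M :&: P :^ x = 1.
Proof.
move=> Gx nMx; have pPx : p.-group (P :^ x) by rewrite pgroupJ.
have sPxG : P :^ x \subset G by rewrite -(conjGid Gx) conjSg.
have nPxM : ~~ (P :^ x \subset M).
  by apply: contra nMx => sPxM; rewrite mem_M // (mincx_pgroup_sub nsPM).
have maxD := modular_maximal_cap modM maxM sPxG nPxM.
pose D := (M :&: P :^ x)%G; have sDP : D \subset P.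
  apply: mincx_pgroup_sub nsPM sMG (subsetIl _ _) _.
  exact: pgroupS (subsetIr _ _) pPx.
have iD : #|P : D| = p.
  rewrite -(p_maximal_index pPx maxD); apply/eqP.
  by rewrite -(eqn_pmul2l (cardG_gt0 D)) !Lagrange ?subsetIr // cardJg.
have maxDP : maximal D P by apply: p_index_maximal; rewrite ?iD.
have genG : P <*> P :^ x = G.
  apply/eqP; apply: contraNT nMx => neG; rewrite mem_M //.
  apply: (@mincx_pgroup_sub (P <*> P :^ x)) => //.
  - apply: IHsub; first exact: joing_subl.
    by rewrite properEneq neG join_subG sPG.
  - by rewrite join_subG sPG.
  exact: joing_subr.
have nsDG : D <| G.
  rewrite /normal subIset ?sMG //= -{1}genG join_subG.
  by rewrite (normal_norm (p_maximal_normal pP maxDP)) (normal_norm (p_maximal_normal pPx maxD)).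
have D1 : D :=: 1.
  apply/eqP; apply: contraNT not_nPG => ntD.
  have := IHquo nsDG ntD.
  by rewrite (normal_quotient_join nsDG sPG) (joing_idPr sDP).
split=> //; first by rewrite -iD D1 indexg1.
Qed.

Let prM : M \proper G. Proof. exact: maxgroupp maxM. Qed.

Lemma mincx_card_P : #|P| = p.
Proof.
by have [_ /subsetPn[x Gx nMx]] := andP prM; have [] := mincx_P Gx nMx.
Qed.

(** [N <*> P] is normal by [IHquo], and is [G], since otherwise [IHsub] would make [P]
    characteristic in it. If [P] is not in [N], then [N] has order prime to [p], and its
    [P]-invariant Sylow subgroups, for primes below [p], are centralised by [P]; so [P] is
    normal. *)
Lemma mincx_simple N : N <| G -> N :!=: 1 -> N :=: G.
Proof.
move=> nsNG ntN; have [sNG nNG] := andP nsNG; have nNP := subset_trans sPG nNG.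
have nsNPG : N <*> P <| G.
  by rewrite -(normal_quotient_join nsNG sPG) IHquo.
have sPNP := joing_subr N P; have sNPG := normal_sub nsNPG.
have nnP : ~~ (P <| N <*> P).
  apply: contra not_nPG => nsP.
  rewrite -(normal_Hall_pcore (pHall_subl sPNP sNPG sylP) nsP).
  exact: gFnormal_trans.
have defG : N <*> P = G.
  by apply/eqP; apply: contraNT nnP => neG; apply: IHsub; rewrite // properEneq neG.
have [sPN | nPN] := boolP (P \subset N).
  by rewrite -[RHS]defG (joing_idPl sPN).
have tiPN : P :&: N = 1 by rewrite prime_TIg ?mincx_card_P.
have coNP : coprime #|N| #|P|.
  have [_ coP] := andP (pHall_Hall sylP); rewrite coprime_sym.
  suff <- : #|G : P| = #|N| by [].
  apply/eqP; rewrite -(eqn_pmul2l (cardG_gt0 P)) Lagrange // -defG norm_joinEr //.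
  by rewrite TI_cardMg 1?setIC // mulnC.
case/negP: nnP.
suff cPN : P \subset 'C(N).
  by rewrite /normal sPNP join_subG normG (subset_trans _ (cent_sub P)) // centsC.
rewrite centsC; apply: sub_of_Sylows => q q_pr.
have [Q sylQ nQP] := sol_coprime_Sylow_exists q (pgroup_sol pP) nNP coNP.
exists Q => //; rewrite centsC; have [sQN qQ _] := and3P sylQ.
have sQG := subset_trans sQN sNG.
have [-> | ntQ] := eqVneq Q 1%G; first exact: cents1.
have [_ q_dv _] := pgroup_pdiv qQ ntQ.
apply: (smU_cent_gt p_pr q_pr _ smG sylP sQG qQ nQP).
rewrite ltn_neqAle p_max ?andbT //; last exact: dvdn_trans q_dv (cardSg sQG).
apply: contraTneq coNP => eq_qp.
rewrite coprime_sym mincx_card_P prime_coprime // negbK -eq_qp.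
exact: dvdn_trans q_dv (cardSg sQN).
Qed.

(** [M :^ y] is modular, maximal and meets [P] trivially, so it generates [G] with [P]; its first
    law with [X := P], [Z := M] gives the factorisation. *)
Lemma mincx_compl y : y \in G -> y \notin M ->
  P * (M :&: M :^ y) = M /\ P :&: (M :&: M :^ y) = 1.
Proof.
move=> Gy nMy; have Gy' : y^-1 \in G by rewrite groupV.
have nMy' : y^-1 \notin M by rewrite groupV.
have sPM := normal_sub nsPM.
have tiP : P :&: M :^ y = 1.
  have [_ ti] := mincx_P Gy' nMy'.
  by rewrite -(conjs1g y) -ti conjIg conjsgKV setIC.
split; last by rewrite setICA tiP setIg1.
have := modularJ y modM; rewrite (conjGid Gy) => /modularP[_ m1 _].
have := m1 P M sPM sMG; rewrite setIC => eqM.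
have nHP : M :&: M :^ y \subset 'N(P) by rewrite subIset ?(normal_norm nsPM).
rewrite -norm_joinEr //= eqM; apply/setIidPr.
suff -> : P <*> M :^ y = G by [].
have maxMy : maximal (M :^ y) G by rewrite -(conjGid Gy) maximalJ.
have /maximal_eqP[_ /(_ (P <*> M :^ y)%G)[||/= eqMy|//]] : maximal_eq (M :^ y) G.
- by rewrite /maximal_eq maxMy orbT.
- exact: joing_subr.
- by rewrite join_subG sPG (maxgroupp maxMy, proper_sub (maxgroupp maxMy)).
have : P \subset P :&: M :^ y by rewrite subsetI subxx -eqMy joing_subl.
rewrite tiP => /trivgP P1; have := prime_gt1 p_pr.
by rewrite -mincx_card_P P1 cards1.
Qed.

(* The centraliser of P in a complement of P in M lies in every such complement,
   hence in all conjugates of M, and so in a proper normal subgroup of G. *)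
Lemma mincx_cent_compl x : x \in G -> x \notin M ->
  'C_(M :&: M :^ x)(P) = 1.
Proof.
move=> Gx nMx.
have L1 : gcore M G = 1.
  apply: contraTeq prM => ntL; have := mincx_simple (gcore_normal sMG) ntL.
  move=> /= defG; have := gcore_sub M G.
  by rewrite defG properE negb_and negbK => ->; rewrite orbT.
apply/trivgP; rewrite -L1; apply/subsetP=> c /setIP[Hc cPc].
apply/bigcapP=> y Gy; have [My | nMy] := boolP (y \in M).
  by rewrite conjGid //; case/setIP: Hc.
have [defMy tiy] := mincx_compl Gy nMy.
have [defMx tix] := mincx_compl Gx nMx.
have : c \in P * (M :&: M :^ y) by rewrite defMy; case/setIP: Hc.
case/mulsgP=> a h Pa Hh def_c.
suff a1 : a = 1 by rewrite def_c a1 mul1g; case/setIP: Hh.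
have cPa : a \in 'C(P).
  have abP : abelian P by rewrite cyclic_abelian ?prime_cyclic ?mincx_card_P.
  exact: subsetP abP a Pa.
have cPh : h \in 'C(P) by rewrite -[h](mulKg a) -def_c groupM // groupV.
have cah : commute a h by apply/esym; apply: (centP cPh).
have cardI z : P * (M :&: M :^ z) = M -> P :&: (M :&: M :^ z) = 1 ->
  (#|M :&: M :^ z| * p = #|M|)%N.
- by move=> defMz /TI_cardMg; rewrite defMz mincx_card_P mulnC.
have eqH : #|M :&: M :^ x| = #|M :&: M :^ y|.
  apply/eqP; rewrite -(eqn_pmul2r (prime_gt0 p_pr)).
  by rewrite (cardI x) // (cardI y).
(* [a] commutes with [h], and the order [m] of the complements kills [c] and [h]; so [a ^+ m = 1],
   with [m] prime to [p]. *)
have am1 : a ^+ #|M :&: M :^ x| = 1.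
  have := expgMn #|M :&: M :^ x| cah; rewrite -def_c.
  rewrite (expg_cardG Hc).
  by rewrite [in h ^+ _]eqH (expg_cardG Hh) mulg1 => <-.
have coPm : coprime #|P| #|M :&: M :^ x|.
  have [_ coP] := andP (pHall_Hall (pHall_subl (normal_sub nsPM) sMG sylP)).
  suff <- : #|M : P| = #|M :&: M :^ x| by [].
  apply/eqP; rewrite -(eqn_pmul2l (cardG_gt0 P)) Lagrange ?(normal_sub nsPM) //.
  by rewrite -(cardI x) // mincx_card_P mulnC.
by rewrite -(expgK coPm Pa) am1 expg1n.
Qed.

(* For a in P other than 1 the complements H and H :^ a meet inside 'C_H(P) = 1,
   while H :&: M :^ (x * a) is maximal in H by modularity. *)
Lemma mincx_card_compl x : x \in G -> x \notin M ->
  #|M :&: M :^ x| = 1%N \/ prime #|M :&: M :^ x|.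
Proof.
move=> Gx nMx; have [_ tiPH] := mincx_compl Gx nMx.
have C1 := mincx_cent_compl Gx nMx; move: tiPH C1.
set H := (M :&: M :^ x)%G; rewrite -[M :&: M :^ x]/(gval H) => tiPH C1.
have [-> | ntH] := eqVneq H 1%G; first by left; rewrite cards1.
right; have P_pr : prime #|P| by rewrite mincx_card_P.
have [a Pa nta] : exists2 a, a \in P & a != 1.
  by apply/trivgPn; rewrite -cardG_gt1 prime_gt1.
have Ma : a \in M := subsetP (normal_sub nsPM) a Pa.
have defP : P :=: <[a]> by rewrite (nt_gen_prime P_pr (x := a)) // !inE nta.
have tiHa : H :&: H :^ a = 1.
  apply/trivgP; rewrite -C1; apply/subsetP=> h /setIP[Hh].
  rewrite mem_conjg => Hk; rewrite inE Hh /= defP cent_cycle.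
  have Mk : h ^ a^-1 \in M by case/setIP: Hk.
  (* With [k = h ^ a^-1], this commutator is [k^-1 * h], in [H]; it is in [P] because [M] normalises
     [P]. *)
  have : [~ h ^ a^-1, a] \in P :&: H.
    rewrite inE {1}commgEr commgEl conjgKV; apply/andP; split; last first.
      by rewrite groupM ?groupV.
    by rewrite groupMr // memJ_norm ?groupV // (subsetP (normal_norm nsPM)).
  rewrite tiPH inE => /commgP cka.
  have <- : h ^ a^-1 = h by rewrite -{2}(conjgKV a h) [RHS]conjgE cka mulKg.
  exact/cent1P.
have Gxa : x * a \in G by rewrite groupM // (subsetP sMG).
have maxMxa : maximal (M :^ (x * a)) G by rewrite -(conjGid Gxa) maximalJ.
have modMxa : modular (M :^ (x * a)) G.
  by have := modularJ (x * a) modM; rewrite (conjGid Gxa).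
have defHa : H :&: M :^ (x * a) = 1.
  have sHM : H \subset M by apply: subsetIl.
  rewrite -tiHa (_ : H :^ a = M :&: M :^ (x * a)).
    by rewrite setIA (setIidPl sHM).
  by rewrite conjIg -conjsgM (conjGid Ma).
have sHG : H \subset G by rewrite subIset ?sMG.
have maxH1 : maximal 1 H.
  have := modular_maximal_cap modMxa maxMxa sHG; rewrite setIC defHa; apply.
  by apply: contra ntH => sH; rewrite -val_eqE /= -subG1 -defHa subsetI subxx.
have [q q_pr q_dv] : exists2 q, prime q & q %| #|H|.
  by exists (pdiv #|H|); rewrite ?pdiv_prime ?pdiv_dvd // cardG_gt1.
have [h Hh oh] := Cauchy q_pr q_dv.
suff -> : H :=: <[h]> by rewrite -orderE oh.
have /maximal_eqP[_ /(_ <[h]>%G)[||/= h1|/= -> //]] : maximal_eq 1 H.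
- by rewrite /maximal_eq maxH1 orbT.
- exact: sub1G.
- by rewrite cycle_subG.
by move: (prime_gt1 q_pr); rewrite -oh orderE h1 cards1.
Qed.

(* For the least prime t, a Sylow t-subgroup T has a subgroup of index dividing t
   in M, whose t-part is at most t; so T is abelian, and by the choice of t it is
   central in its normaliser: Burnside's transfer theorem applies. *)
Lemma mincx_false : False.
Proof.
have [_ /subsetPn[x Gx nMx]] := andP prM.
have [defMx tiPx] := mincx_compl Gx nMx.
have oM : #|M| = (p * #|M :&: M :^ x|)%N.
  by move: (TI_cardMg tiPx); rewrite defMx mincx_card_P.
have G_gt1 : 1 < #|G|.
  apply: leq_trans (prime_gt1 p_pr) _.
  by rewrite -mincx_card_P dvdn_leq ?cardSg.
pose t := pdiv #|G|; have t_pr : prime t := pdiv_prime G_gt1.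
have [T sylT] := Sylow_exists t G; have [sTG tT _] := and3P sylT.
have ntT : T :!=: 1.
  rewrite -cardG_gt1 (card_Hall sylT) p_part_gt1 mem_primes t_pr cardG_gt0.
  exact: pdiv_dvd.
have neTG : T :!=: G.
  apply: contraNneq not_nPG => eqTG; have p_dv : p %| #|G|.
    by rewrite -mincx_card_P cardSg.
  have tG : t.-group G by rewrite -eqTG.
  have /eqnP eq_pt : p \in (t : nat_pred) := pgroupP tG p p_pr p_dv.
  by rewrite (pHall_id sylP) ?normal_refl // eq_pt.
have abT : abelian T.
  have [eq_tp | neq_tp] := eqVneq t p.
    rewrite cyclic_abelian // prime_cyclic // (card_Hall sylT) eq_tp.
    by rewrite -(card_Hall sylP) mincx_card_P.
  apply: (p2group_abelian tT).
  have logTM : logn t #|M :&: T| <= 1.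
    apply: (@leq_trans (logn t #|M|)).
      by rewrite dvdn_leq_log // cardSg // subsetIl.
    rewrite oM lognM ?(prime_gt0 p_pr) //.
    rewrite (logn_prime _ p_pr) (negPf neq_tp).
    have [-> | H_pr] := mincx_card_compl Gx nMx; first by rewrite logn1.
    by rewrite logn_prime //; case: eqP.
  have [sTM | nTM] := boolP (T \subset M).
    by rewrite -(setIidPr sTM) (leq_trans logTM).
  have maxMT := modular_maximal_cap modM maxM sTG nTM.
  rewrite -(Lagrange (subsetIr M T)) (p_maximal_index tT maxMT) /=.
  by rewrite lognM ?(prime_gt0 t_pr) // (logn_prime _ t_pr) eqxx addn1.
have cNT : 'N_G(T) \subset 'C(T).
  have sNG : 'N_G(T) \subset G := subsetIl _ _.
  have sTN : T \subset 'N_G(T) by rewrite subsetI sTG normG.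
  apply: sub_of_Sylows => s s_pr; have [S sylS] := Sylow_exists s 'N_G(T).
  exists S => //; have [sSN sS _] := and3P sylS; have [eq_st | neq_st] := eqVneq s t.
    apply: subset_trans abT; rewrite (sub_normal_Hall (pHall_subl sTN sNG sylT)) //.
      by rewrite -eq_st.
    by rewrite /normal sTN subsetIr.
  have [-> | ntS] := eqVneq S 1%G; first exact: sub1G.
  have [_ s_dv _] := pgroup_pdiv sS ntS.
  have nTS : S \subset 'N(T) by rewrite (subset_trans sSN) ?subsetIr.
  apply: (smU_cent_gt s_pr t_pr _ (smU_sub sNG smG) sylS sTN tT nTS).
  rewrite ltn_neqAle eq_sym neq_st pdiv_min_dvd ?prime_gt1 //.
  by apply: dvdn_trans s_dv (cardSg (subset_trans sSN sNG)).
have [K nsKG [tiKT abGK]] := Burnside_transfer sylT cNT.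
(* By simplicity [K] is trivial or [G]; the latter contradicts [T != 1], the former makes [G]
   abelian. *)
have [K1 | ntK] := eqVneq K 1%G; last first.
  by case/eqP: ntT; rewrite -tiKT (mincx_simple nsKG ntK); apply/esym/setIidPr.
case/negP: not_nPG; rewrite -sub_abelian_normal //.
by move: abGK; rewrite K1 -(isog_abelian (quotient1_isog G)).
Qed.

End MinimalCounterexample.

Theorem smU_max_Sylow_normal (gT : finGroupType) p (G P : {group gT}) :
    prime p -> smU G -> (forall q, prime q -> q %| #|G| -> q <= p) ->
  p.-Sylow(G) P -> P <| G.
Proof.
move=> p_pr; have [n] := ubnP #|G|.
elim: n => // n IHn in gT G P * => leGn smG p_max sylP.
apply/idPn=> not_nPG; have sPG := pHall_sub sylP.
have IHsub (H : {group gT}) : P \subset H -> H \proper G -> P <| H.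
  move=> sPH prH; have sHG := proper_sub prH; apply: IHn.
  - exact: leq_trans (proper_card prH) leGn.
  - exact: smU_sub sHG smG.
  - by move=> q q_pr q_dv; apply: p_max q_pr (dvdn_trans q_dv (cardSg sHG)).
  exact: pHall_subl sPH sHG sylP.
have IHquo (N : {group gT}) : N <| G -> N :!=: 1 -> P / N <| G / N.
  move=> nsNG ntN; have [sNG nNG] := andP nsNG; apply: IHn.
  - exact: leq_trans (ltn_quotient ntN sNG) leGn.
  - exact: smU_quotient.
  - by move=> q q_pr q_dv; apply: p_max q_pr (dvdn_trans q_dv (dvdn_quotient _ _)).
  exact: quotient_pHall (subset_trans sPG nNG) sylP.
have [M [modM maxM defM]] := mincx_modular p_pr smG sylP IHsub not_nPG.
exact: (mincx_false p_pr smG sylP p_max IHsub IHquo not_nPG modM maxM defM).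
Qed.

(** If the largest prime divisor of [#|G|] were not [r], its normal Sylow subgroup would be a
    nontrivial part of ['O_r^'(G)]. *)
Lemma smU_Sylow_normal (gT : finGroupType) (r : nat) (G R : {group gT}) :
  smU G -> 'O_r^'(G) = 1 -> r.-Sylow(G) R -> R <| G.
Proof.
move=> smG r'1 sylR; have [R1 | ntR] := eqVneq R 1%G.
  by rewrite R1 normal1.
have [r_pr r_dv _] := pgroup_pdiv (pHall_pgroup sylR) ntR.
have G_gt1 : 1 < #|G|.
  apply: leq_trans (prime_gt1 r_pr) _; apply: dvdn_leq => //.
  exact: dvdn_trans r_dv (cardSg (pHall_sub sylR)).
pose p := max_pdiv #|G|; have p_pr : prime p by rewrite max_pdiv_prime.
have p_max q : prime q -> q %| #|G| -> q <= p.
  by move=> q_pr q_dv; rewrite max_pdiv_max // mem_primes q_pr cardG_gt0.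
have [P sylP] := Sylow_exists p G.
have nsPG := smU_max_Sylow_normal p_pr smG p_max sylP.
suff eq_rp : r = p.
  by apply: smU_max_Sylow_normal sylR; rewrite ?eq_rp.
apply/eqP; apply: contraT => neq_rp.
have: P \subset 'O_r^'(G).
  rewrite pcore_max //; apply: sub_pgroup (pHall_pgroup sylP) => q.
  by rewrite !inE => /eqP->; rewrite eq_sym.
rewrite r'1 => /trivgP P1; have := card_Hall sylP; rewrite P1 cards1 => /esym/eqP.
by rewrite p_part_eq1 mem_primes p_pr cardG_gt0 max_pdiv_dvd.
Qed.

(** * Submodularity from the action *)

(** The minimal polynomial divides ['X^#|F| - 'X], a product of linear factors over [F], and is not
    constant. *)
Lemma mx_eigenvalue_Frobenius (F : finFieldType) n (A : 'M[F]_n.+1) :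
  (A ^+ #|F| = A)%R -> exists a, eigenvalue A a.
Proof.
move=> AF; have /mxminpoly_min : horner_mx A ('X^#|F| - 'X)%R = 0%R.
  by rewrite GRing.rmorphB GRing.rmorphXn /= horner_mx_X AF GRing.subrr.
rewrite finField_genPoly => /dvdp_prod_XsubC[m].
case: (mask m _) => [|a s] eq_pA.
  have := mxminpoly_nonconstant A; have := size_mxminpoly A.
  by rewrite (eqp_size eq_pA) big_nil size_poly1 => -[<-].
exists a; rewrite eigenvalue_root_min (eqp_root eq_pA) big_cons.
by rewrite rootM root_XsubC eqxx.
Qed.

Section ScalarAction.

Variables (gT : finGroupType) (r : nat).
Hypothesis r_pr : prime r.
Implicit Types E P : {group gT}.

(** [a] acts on [E] over the field of [r] elements by a matrix [A] with [A ^+ r = A]; the eigenvalue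
    is read as an exponent. *)
Lemma abelem_eigenvector E a :
    r.-abelem E -> E :!=: 1 -> a \in 'N(E) -> a ^+ r.-1 \in 'C(E) ->
  exists2 v, v \in E^# & exists c, v ^ a = v ^+ c.
Proof.
move=> abelE ntE Na car; have nE : <[a]> \subset 'N(E) by rewrite cycle_subG.
pose rG := abelem_repr abelE ntE nE; have aa := cycle_id a.
have [b] : exists b, eigenvalue (rG a) b.
  apply: mx_eigenvalue_Frobenius; rewrite card_Fp // -[X in (_ ^+ X)%R](prednK (prime_gt0 r_pr)).
  rewrite GRing.exprS -repr_mxX //.
  have /rkerP[_ ->] : a ^+ r.-1 \in rker rG.
    by rewrite rker_abelem inE car mem_cycle.
  by rewrite GRing.mulr1.
case/eigenvalueP=> u ub ntu; exists (rVabelem abelE ntE u).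
  rewrite !inE mem_rVabelem andbT; apply: contraNneq ntu => u1.
  by apply/eqP/(@rVabelem_inj _ _ _ abelE ntE); rewrite rVabelem0.
by exists b; rewrite -rVabelemZ -ub rVabelemJ.
Qed.

(** The set [W] on which [a] acts as the power [c] is [P]-invariant as commutators act trivially, so
    it is [E]. Thus every cyclic subgroup of [E] is [P]-invariant. *)
Lemma minnormal_scalar_prime E P :
    minnormal E P -> r.-abelem E -> P^`(1) \subset 'C(E) ->
    {in P, forall a, a ^+ r.-1 \in 'C(E)} ->
  #|E| = r.
Proof.
move=> minE abelE cP'E cPrE; have /andP[ntE nEP] := mingroupp minE.
have cEE := abelem_abelian abelE.
have inv a v : a \in P -> v \in E -> v ^ a \in <[v]>.
  move=> Pa Ev; have [u Eu [c uc]] :=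
    abelem_eigenvector abelE ntE (subsetP nEP a Pa) (cPrE a Pa).
  pose W := [set w in E | w ^ a == w ^+ c].
  have gW : group_set W.
    apply/group_setP; split; first by rewrite !inE group1 conj1g expg1n eqxx.
    move=> x y; rewrite !inE => /andP[Ex /eqP xc] /andP[Ey /eqP yc].
    rewrite groupM //= conjMg xc yc expgMn //.
    exact: (centsP cEE).
  suff defW : W :=: E.
    by move: Ev; rewrite -defW inE => /andP[_ /eqP->]; apply: mem_cycle.
  have [_ minE'] := mingroupP minE.
  apply: (minE' (Group gW)); last by apply/subsetP=> w; rewrite inE => /andP[].
  apply/andP; split.
    have [ntu Eu'] := setD1P Eu; apply: contraNneq ntu => W1.
    have Wu : u \in Group gW by rewrite inE Eu' uc eqxx.
    by move: Wu; rewrite W1 => /set1P->.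
  apply/subsetP=> b Pb; rewrite inE; apply/subsetP=> _ /imsetP[w Ww ->].
  move: Ww; rewrite !inE memJ_norm ?(subsetP nEP) // => /andP[Ew /eqP wc].
  rewrite Ew /= -conjXg -wc -!conjgM.
  have cba : [~ b, a] \in 'C(E) by apply: (subsetP cP'E); apply: mem_commg.
  have Ewab : w ^ (a * b) \in E by rewrite conjgM !memJ_norm ?(subsetP nEP).
  by rewrite commgC conjgM [X in X == _]conjgE -(centP cba _ Ewab) mulKg.
have [v /setD1P[ntv Ev]] : exists v, v \in E^#.
  by have /trivgPn[v Ev ntv] := ntE; exists v; rewrite !inE ntv.
suff <- : <[v]> = E by rewrite -orderE (abelem_order_p abelE).
have [_ minE'] := mingroupP minE; apply: minE'; last by rewrite cycle_subG.
rewrite /= cycle_eq1 ntv; apply/subsetP=> a Pa; rewrite inE.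
by rewrite -cycleJ cycle_subG inv.
Qed.

End ScalarAction.

Lemma modular1 (gT : finGroupType) (G : {group gT}) : modular 1 G.
Proof.
apply/(modularP G 1%G); split; first exact: sub1G.
  by move=> X Z sXZ sZG /=; rewrite setI1g joingG1 (setIidPl sXZ).
by move=> Y Z sYG sZG _ /=; rewrite !joing1G.
Qed.

(** For [a = #|Z|], [b = #|G : Z|]: proper nontrivial subgroups of a group of order [m * i] have
    prime order. *)
Lemma prime_mul_proper_dvd m i q a b :
  prime m -> prime i -> prime q -> q %| a -> (a * b)%N = (m * i)%N -> 1 < b ->
  a = q.
Proof.
move=> m_pr i_pr q_pr /dvdnP[k ->]; wlog ->: m i m_pr i_pr / q = m => [IH|].
  move=> eq_mi b_gt1; have : q %| m * i.
    by rewrite -eq_mi mulnAC dvdn_mull.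
  rewrite Euclid_dvdM // !dvdn_prime2 // => /orP[] /eqP eq_q.
    exact: (IH m i).
  by apply: (IH i m) => //; rewrite eq_mi mulnC.
move=> /eqP; rewrite mulnAC mulnC eqn_pmul2l ?prime_gt0 // => /eqP eq_kb b_gt1.
have : k %| i by rewrite -eq_kb dvdn_mulr.
case/primeP: i_pr => i_gt1 /[apply] /orP[] /eqP defk; first by rewrite defk mul1n.
case/eqP: (gtn_eqF b_gt1); apply/eqP.
by rewrite -(eqn_pmul2l (ltnW i_gt1)) -{1}defk eq_kb muln1.
Qed.

(** [M] is maximal, whence the second law. For the first, if [M] is not in [Z], then [M :&: Z = 1]
    and [Z] is trivial or of prime order, which forces [X = Z] unless [X] is trivial. *)
Lemma modular_prime_index (gT : finGroupType) (G M : {group gT}) :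
  M \subset G -> prime #|M| -> prime #|G : M| -> modular M G.
Proof.
move=> sMG M_pr iM_pr; have maxM := p_index_maximal sMG iM_pr.
apply/modularP; split=> // [X Z sXZ sZG | Y Z sYG sZG sMZ]; last first.
  have /maximal_eqP[_ /(_ Z sMZ sZG)[]->] : maximal_eq M G.
  - by rewrite /maximal_eq maxM orbT.
  - rewrite (joing_idPl (subsetIr _ _)); apply/esym/setIidPr; exact: joing_subl.
  by rewrite (setIidPl sYG) (setIidPl _) // join_subG sMG.
have [sMZ | nMZ] := boolP (M \subset Z).
  by rewrite (setIidPl sMZ) (setIidPl _) // join_subG sXZ.
have tiMZ : M :&: Z = 1 by rewrite prime_TIg.
rewrite tiMZ joingG1; have [sXM | nXM] := boolP (X \subset M).
  by rewrite (joing_idPr sXM) tiMZ; apply/trivgP; rewrite -tiMZ subsetI sXM.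
apply/eqP; rewrite eqEsubset subsetI joing_subl sXZ /=.
suff -> : Z :=: X by apply: subsetIr.
have ntX : 1 < #|X| by rewrite cardG_gt1; apply: contraNneq nXM => ->; apply: sub1G.
have q_pr := pdiv_prime ntX; have q_dv := pdiv_dvd #|X|.
have oZ : #|Z| = pdiv #|X|.
  apply: (prime_mul_proper_dvd M_pr iM_pr q_pr (b := #|G : Z|)).
  - exact: dvdn_trans q_dv (cardSg sXZ).
  - by rewrite !Lagrange.
  by rewrite indexg_gt1; apply: contra nMZ; apply: subset_trans.
by apply/eqP; rewrite eq_sym eqEcard sXZ oZ dvdn_leq.
Qed.

(** Modulo ['C_P(R)] the image of [P] is cyclic, inside [Aut R], with exponent dividing [p]: its
    order is 1 or [p], and its index [r]. *)
Lemma modular_act_prime (gT : finGroupType) p r (P R : {group gT}) :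
    prime p -> prime r -> p != r -> p.-group P -> #|R| = r -> P \subset 'N(R) ->
    exp_residual (gcdn p r.-1) P \subset 'C(R) ->
  modular P (R <*> P).
Proof.
move=> p_pr r_pr neq_pr pP oR nRP /exp_residual_subP[_ cPn].
have rR : r.-group R by rewrite /pgroup oR pnat_id.
have coRP := pgroup_coprime neq_pr pP rR.
pose C := 'C_P(R)%G; have sCP : C \subset P := subsetIl _ _.
have nsCP : C <| P by rewrite /normal sCP normsI ?normG // norms_cent.
have nsCG : C <| R <*> P.
  rewrite /normal (subset_trans sCP) ?joing_subr //= join_subG.
  by rewrite (normal_norm nsCP) cents_norm // centsC subsetIr.
have iP : #|R <*> P : P| = r.
  apply/eqP; rewrite -(eqn_pmul2l (cardG_gt0 P)) Lagrange ?joing_subr //.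
  by rewrite /= norm_joinEr // coprime_cardMg // oR mulnC.
apply: (modular_quotient_lift nsCG sCP (joing_subr _ _)).
have R_pr : prime #|R| by rewrite oR.
have isoPC : P / C \isog conj_aut R @* P.
  have := first_isog_loc (conj_aut R) nRP.
  by rewrite /= ker_conj_aut.
have /cyclicP[x defPC] : cyclic (P / C).
  rewrite (isog_cyclic isoPC).
  by apply: cyclicS (Aut_conj_aut R P) (Aut_prime_cyclic R_pr).
have xp : x ^+ p = 1.
  have : x \in P / C by rewrite defPC cycle_id.
  case/morphimP=> a Na Pa ->; rewrite -morphX //; apply: coset_id.
  rewrite inE groupX //=.
  by have /dvdnP[k ->] := dvdn_gcdl p r.-1; rewrite mulnC expgM groupX ?cPn.
have [x1 | ntx] := eqVneq x 1.
  by rewrite defPC x1 cycle1; apply: modular1.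
apply: modular_prime_index; first exact: quotientS (joing_subr _ _).
  by rewrite /= defPC -orderE (nt_prime_order p_pr).
by rewrite index_quotient_eq ?iP ?joing_subr ?(normal_norm nsCG) // subIset // sCP orbT.
Qed.

(** A minimal [P]-invariant [E] in ['Z(R)] is normal in [R <*> P] and of order [r], so [P] is
    modular in [E <*> P]; induction applies modulo [E]. *)
Lemma exp_residual_cent_submodular (gT : finGroupType) p r (P R : {group gT}) :
    prime p -> prime r -> p != r -> p.-group P -> r.-group R -> P \subset 'N(R) ->
    exp_residual (gcdn p r.-1) P \subset 'C(R) ->
  submodular P (R <*> P)%G.
Proof.
move=> p_pr r_pr neq_pr; have [n] := ubnP #|R|.
elim: n => // n IHn in gT P R * => leRn pP rR nRP cRP.
have [-> | ntR] := eqVneq R 1%G.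
  rewrite (_ : 1 <*> P = P)%G; first exact: submodular_refl.
  by apply: val_inj; rewrite /= joing1G.
have ntZ : 'Z(R) != 1 by rewrite (center_nil_eq1 (pgroup_nil rR)).
have nZP : P \subset 'N('Z(R)) := char_norm_trans (center_char R) nRP.
have [E minE sEZ] := minnormal_exists ntZ nZP.
have sER : E \subset R := subset_trans sEZ (center_sub R).
have rE := pgroupS sER rR.
have [nEP ntE abelE'] := minnormal_solvable minE (subxx E) (pgroup_sol rE).
have abelE : r.-abelem E by rewrite -(is_abelem_pgroup rE).
have sPRP : P \subset R <*> P := joing_subr _ _.
have nEG : R <*> P \subset 'N(E).
  by rewrite join_subG nEP andbT cents_norm // centsC (subset_trans sEZ) ?subsetIr.
have nsEG : E <| R <*> P by rewrite /normal nEG (subset_trans sER) ?joing_subl.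
have nER : R \subset 'N(E) := subset_trans (joing_subl _ _) nEG.
have cEP : exp_residual (gcdn p r.-1) P \subset 'C(E) := subset_trans cRP (centS sER).
have oE : #|E| = r.
  have [cP'E cPnE] := exp_residual_subP _ _ _ cEP.
  apply: (minnormal_scalar_prime r_pr minE abelE cP'E) => a Pa.
  by have /dvdnP[k ->] := dvdn_gcdr p r.-1; rewrite mulnC expgM groupX ?cPnE.
apply: (@submodular_trans _ (E <*> P)%G).
  apply: modular_submodular.
  exact: (modular_act_prime p_pr r_pr neq_pr pP oE nEP cEP).
apply: (submodular_quotient_lift nsEG); first exact: joing_subl.
  by rewrite join_subG (normal_sub nsEG).
have -> : ((E <*> P) / E = P / E)%G by apply: val_inj; rewrite /= quotientYidl.
have -> : ((R <*> P) / E = (R / E) <*> (P / E))%G.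
  by apply: val_inj; rewrite /= quotientY.
apply: IHn; rewrite ?quotient_pgroup ?quotient_norms //.
  exact: leq_trans (ltn_quotient ntE sER) leRn.
by rewrite -exp_residual_quotient // quotient_cents.
Qed.

(** * Saturation *)

(** ['N_G(K)] generates [G] with ['Phi(G)], so it is [G]. Applied to Schur-Zassenhaus complements
    and to Sylow subgroups. *)
Lemma Frattini_normal (gT : finGroupType) (G N K : {group gT}) :
    N \subset 'Phi(G) -> K \subset G -> G \subset N * 'N_G(K) -> K <| G.
Proof.
move=> sNPhi sKG sGNN; rewrite /normal sKG.
have defG : 'Phi(G) <*> 'N_G(K) = G.
  apply/eqP; rewrite eqEsubset join_subG Phi_sub subsetIl /=.
  apply: subset_trans sGNN _; rewrite mul_subG ?joing_subr //.
  exact: subset_trans sNPhi (joing_subl _ _).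
have := Phi_nongen defG; rewrite genGid => {1}<-; exact: subsetIr.
Qed.

(** [N] and [K] may be incomparable; the claim amounts to the image of [N <*> P] modulo [K] staying
    submodular. *)
Lemma smU_quotient_quotient (gT : finGroupType) (G N K : {group gT}) :
  N <| G -> K <| G -> smU (G / N)%G -> smU ((G / K) / (N / K))%G.
Proof.
move=> nsNG nsKG /(smU_quotientP nsNG) smGN; have nKG := normal_norm nsKG.
apply/(smU_quotientP (quotient_normal K nsNG)) => p Q p_pr.
case/(Sylow_morphim_ex nKG)=> P sylP ->.
have -> : ((N / K) <*> (coset_morphism K @* P) = (N <*> P) / K)%G.
  apply: val_inj; rewrite /= quotientY // (subset_trans _ nKG) //.
    exact: normal_sub.
  exact: pHall_sub sylP.
exact: submodular_morphim nKG (smGN p P p_pr sylP).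
Qed.

(* By Gaschuetz's theorem G / 'Phi(R) splits over N / 'Phi(R), which lies in the
   Frattini subgroup of that quotient and is therefore trivial. *)
Lemma sub_Phi_normal_Sylow (gT : finGroupType) (r : nat) (G R N : {group gT}) :
    r.-Sylow(G) R -> R <| G -> N <| G -> N \subset R -> N \subset 'Phi(G) ->
  N \subset 'Phi(R).
Proof.
move=> sylR nsRG nsNG sNR sNPhi; have [sRG rR _] := and3P sylR.
pose Q := 'Phi(R)%G.
have nsQG : Q <| G by apply: char_normal_trans (Phi_char R) nsRG.
have nQG := normal_norm nsQG; have sNG := normal_sub nsNG.
have abelR : r.-abelem (R / Q) := Phi_quotient_abelem rR.
have sNR' : N / Q \subset R / Q by apply: quotientS.
have abN : abelian (N / Q) := abelianS sNR' (abelem_abelian abelR).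
have coN : coprime #|N / Q| #|G / Q : R / Q|.
  have [_ coR] := andP (pHall_Hall (quotient_pHall (subset_trans sRG nQG) sylR)).
  exact: coprimeSg sNR' coR.
have := Gaschutz_split (quotient_normal Q nsNG) sNR' (quotientS Q sRG) abN coN.
rewrite (abelem_splits abelR sNR') => /splitsP[B /complP[tiNB defG]].
have sNPhi' : N / Q \subset 'Phi(G / Q).
  exact: subset_trans (quotientS Q sNPhi) (morphimF _ _ nQG).
have defB : B :=: G / Q.
  have sBG : B \subset G / Q by rewrite -defG mulG_subr.
  have := @Phi_nongen _ (G / Q)%G B; rewrite genGid; apply.
  apply/eqP; rewrite eqEsubset join_subG Phi_sub sBG /= -{1}defG mul_subG ?joing_subr //.
  exact: subset_trans sNPhi' (joing_subl _ _).
have nQN : N \subset 'N(Q) := subset_trans sNG nQG.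
rewrite -quotient_sub1 // -tiNB subsetI subxx defB; exact: quotientS.
Qed.

Section FrattiniExtension.

Variables (gT : finGroupType) (G N : {group gT}) (r : nat).
Hypotheses (r_pr : prime r) (nsNG : N <| G) (sNPhi : N \subset 'Phi(G)).
Hypotheses (rN : r.-group N) (smGN : smU (G / N)%G).

Let sNG : N \subset G := normal_sub nsNG.
Let nNG : G \subset 'N(N) := normal_norm nsNG.

(** [N] is a normal Sylow subgroup of the preimage [L] of ['O_r^'(G / N)]; its complements in [L]
    are conjugate under [N], so [G = N * 'N_G(K)]. *)
Lemma Frattini_normal_compl : exists K : {group gT},
  [/\ K <| G, N :&: K = 1 & (N <*> K) / N = 'O_r^'(G / N)].
Proof.
have [L defL sNL nsLG] := inv_quotientN nsNG (pcore_normal r^' (G / N)).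
have sLG := normal_sub nsLG; have nsNL := normalS sNL sLG nsNG.
have r'LN : r^'.-group (L / N) by rewrite -defL pcore_pgroup.
have hallN : r.-Hall(L) N.
  by rewrite /pHall sNL rN -card_quotient ?normal_norm.
have /splitsP[K /complP[tiNK defNK]] := SchurZassenhaus_split (pHall_Hall hallN) nsNL.
have sKL : K \subset L by rewrite -defNK mulG_subr.
have sKG := subset_trans sKL sLG; have nNK := subset_trans sKG nNG.
exists K; split=> //; last by rewrite norm_joinEr // defNK defL.
apply: (Frattini_normal sNPhi sKG); apply/subsetP=> g Gg.
have coNK : coprime #|N| #|K|.
  apply: (pnat_coprime rN); have := r'LN.
  by rewrite -defNK quotientMidl /pgroup -(card_isog (quotient_isog nNK tiNK)).
have [|x Nx defKg] := SchurZassenhaus_trans_sol (pgroup_sol rN) nNK _ coNK (cardJg K g).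
  by rewrite defNK -(normsP (normal_norm nsLG) g Gg) conjSg.
rewrite -normC; last by rewrite subIset ?nNG.
rewrite -(mulgKV x g) mem_mulg // !inE groupM ?groupV ?(subsetP sNG x) //=.
by rewrite conjsgM defKg conjsgK.
Qed.

Lemma Frattini_exp_residual_cent p (P : {group gT}) :
    prime p -> p != r -> p.-Sylow(G) P ->
  exp_residual (gcdn p r.-1) P \subset 'C(N).
Proof.
move=> p_pr neq_pr sylP; have [K [nsKG tiNK defNK]] := Frattini_normal_compl.
have [sPG pP _] := and3P sylP; have [sKG nKG] := andP nsKG.
have nKN := subset_trans sNG nKG; have nKP := subset_trans sPG nKG.
have [R sylR] := Sylow_exists r G; have [sRG rR _] := and3P sylR.
have nKR := subset_trans sRG nKG; have nNR := subset_trans sRG nNG.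
have sNR : N \subset R.
  by apply: subset_trans (pcore_sub_Hall sylR); apply: pcore_max.
have sylRK := quotient_pHall nKR sylR.
(* [N <*> K <*> R] is the preimage of the normal Sylow [r]-subgroup of [G / N] modulo its
   [r^']-core, and equals [K <*> R]. *)
have nsRK : R / K <| G / K.
  have smr : smU (G / N / 'O_r^'(G / N))%G.
    exact: smU_quotient (pcore_normal _ _) smGN.
  have sylRN := quotient_pHall nNR sylR.
  have nr'R : R / N \subset 'N('O_r^'(G / N)).
    exact: subset_trans (quotientS N sRG) (normal_norm (pcore_normal _ _)).
  have := smU_Sylow_normal smr (trivg_pcore_quotient _ _) (quotient_pHall nr'R sylRN).
  rewrite (normal_quotient_join (pcore_normal _ _)) ?quotientS //= -defNK.
  rewrite -quotientY ?(join_subG, nNR, normG, subset_trans sKG) //.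
  have sNKRG : (N <*> K) <*> R \subset G by rewrite !join_subG sNG sKG.
  rewrite (normal_quotient_join nsNG sNKRG) (normal_quotient_join nsKG sRG).
  suff -> : N <*> (N <*> K <*> R) = K <*> R by [].
  have sNKR : N \subset K <*> R := subset_trans sNR (joing_subr K R).
  by rewrite -(joingA N K R) !(joing_idPr sNKR).
pose E := exp_residual_group (gcdn p r.-1) P.
rewrite -[exp_residual _ P]/(gval E); have sEP : E \subset P := exp_residual_sub _ P.
have nsNK : N / K <| G / K := quotient_normal K nsNG.
have sNRK : N / K \subset R / K := quotientS K sNR.
have sNPhiK : N / K \subset 'Phi(G / K).
  exact: subset_trans (quotientS K sNPhi) (morphimF _ _ nKG).
have sNPhiR := sub_Phi_normal_Sylow sylRK nsRK nsNK sNRK sNPhiK.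
have sylPK := quotient_pHall nKP sylP.
have nNK : G / K \subset 'N(N / K) := normal_norm nsNK.
have nNPK : P / K \subset 'N(N / K) := subset_trans (quotientS K sPG) nNK.
have nNRK : R / K \subset 'N(N / K) := subset_trans (quotientS K sRG) nNK.
have nRPK : P / K \subset 'N(R / K).
  exact: subset_trans (quotientS K sPG) (normal_norm nsRK).
(* The double quotient is in [smU], so [E] centralises [R] modulo [N] and [K]; as [N / K] is in
   ['Phi(R / K)], coprime action removes [N]. *)
have cEN : (E / K) / (N / K) \subset 'C((R / K) / (N / K)).
  rewrite [E / K]exp_residual_quotient // exp_residual_quotient //.
  have smGK := smU_quotient_quotient nsNG nsKG smGN.
  apply: (smU_exp_residual_cent p_pr r_pr neq_pr smGK (quotient_pHall nNPK sylPK)).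
  - by rewrite !quotientS.
  - by rewrite !quotient_pgroup.
  exact: quotient_norms.
have nNEK : E / K \subset 'N(N / K) := subset_trans (quotientS K sEP) nNPK.
have cER : E / K \subset 'C(R / K).
  have rRK : r.-group (R / K) := quotient_pgroup K rR.
  apply: (coprime_cent_join_Phi rRK (S := 1%G)).
  - by apply: pgroup_coprime (quotient_pgroup K (pgroupS sEP pP)) rRK.
  - exact: subset_trans (quotientS K sEP) nRPK.
  - exact: sub1G.
  - exact: cents1.
  by rewrite joing1G; apply: subset_trans sNPhiR; rewrite -quotient_cents2.
(* [[~: E, N]] lies in [N] and, by [cER], in [K]. *)
apply/commG1P/trivgP; rewrite -tiNK subsetI.
have nNE : E \subset 'N(N) := subset_trans (subset_trans sEP sPG) nNG.
rewrite commg_subr nNE /= -quotient_cents2 ?(subset_trans sEP) //.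
exact: subset_trans cER (centS sNRK).
Qed.

End FrattiniExtension.

(** It remains to go from [P] to [N <*> P]: these are equal if [p = r], and the action of [P] on [N]
    decides otherwise. *)
Lemma smU_Frattini_pgroup (gT : finGroupType) (r : nat) (G N : {group gT}) :
    prime r -> N <| G -> N \subset 'Phi(G) -> r.-group N -> smU (G / N)%G ->
  smU G.
Proof.
move=> r_pr nsNG sNPhi rN smGN p P p_pr sylP.
have [sPG pP _] := and3P sylP.
have subNP := (smU_quotientP nsNG).1 smGN p P p_pr sylP.
apply: submodular_trans subNP; have [eq_pr | neq_pr] := eqVneq p r.
  have sNP : N \subset P.
    apply: subset_trans (pcore_sub_Hall sylP); apply: pcore_max => //.
    by rewrite eq_pr.
  rewrite (_ : N <*> P = P)%G; first exact: submodular_refl.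
  by apply: val_inj; apply/joing_idPr.
apply: (exp_residual_cent_submodular p_pr r_pr neq_pr pP rN).
  exact: subset_trans sPG (normal_norm nsNG).
exact: (Frattini_exp_residual_cent r_pr nsNG sNPhi rN smGN p_pr neq_pr sylP).
Qed.

(** Peels off one prime: a Sylow subgroup [S] of [N] is normal in [G] by the Frattini argument, and
    induction treats [N / S]. *)
Lemma smU_Frattini (gT : finGroupType) (G N : {group gT}) :
  N <| G -> N \subset 'Phi(G) -> smU (G / N)%G -> smU G.
Proof.
have [n] := ubnP #|N|; elim: n => // n IHn in gT G N * => leNn nsNG sNPhi smGN.
have [N1 | ntN] := eqVneq N 1%G.
  apply: smU_isog smGN; rewrite isog_sym N1; exact: quotient1_isog.
have N_gt1 : 1 < #|N| by rewrite cardG_gt1.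
pose r := pdiv #|N|; have r_pr : prime r := pdiv_prime N_gt1.
have [S sylS] := Sylow_exists r N; have [sSN rS _] := and3P sylS.
have [sNG nNG] := andP nsNG; have sSG := subset_trans sSN sNG.
have nsSG : S <| G.
  by apply: (Frattini_normal sNPhi sSG); rewrite (Frattini_arg nsNG sylS).
have ntS : S :!=: 1.
  rewrite -cardG_gt1 (card_Hall sylS) p_part_gt1 mem_primes r_pr cardG_gt0.
  exact: pdiv_dvd.
have sSPhi := subset_trans sSN sNPhi; have nSG := normal_norm nsSG.
apply: (smU_Frattini_pgroup r_pr nsSG sSPhi rS).
apply: (IHn _ _ (N / S)%G).
- exact: leq_trans (ltn_quotient ntS sSN) leNn.
- exact: quotient_normal.
- exact: subset_trans (quotientS S sNPhi) (morphimF _ _ nSG).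
exact: smU_quotient_quotient.
Qed.

Theorem theorem3p1 (gT : finGroupType) (G : {group gT}) :
  (forall H : {group gT}, smU G -> H \subset G -> smU H) /\
  (forall N : {group gT}, smU G -> N <| G -> smU (G / N)%G) /\
  (forall N1 N2 : {group gT}, N1 <| G -> N2 <| G ->
     smU (G / N1)%G -> smU (G / N2)%G -> smU (G / (N1 :&: N2))%G) /\
  (forall H1 H2 : {group gT}, smU H1 -> smU H2 -> H1 <| G -> H2 <| G ->
     H1 :&: H2 = 1 ->
     exists2 K : {group gT}, H1 \x H2 = K & smU K) /\
  (smU (G / 'Phi(G))%G -> smU G) /\
  (formation smU /\ hereditary smU /\ saturated smU).
Proof.
have satU : saturated smU.
  by move=> rT K; apply: smU_Frattini (Phi_normal K) (subxx _).
split; first by move=> H smG sHG; apply: smU_sub smG.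
split; first by move=> N smG nsNG; apply: smU_quotient.
split; first exact: smU_quotientI.
split.
  move=> H1 H2 sm1 sm2 nsH1 nsH2 tiH.
  (* [H1 \x H2] is the empty set unless the factors commute; here their commutator lies in
     [H1 :&: H2]. *)
  have cH : H2 \subset 'C(H1).
    rewrite centsC; apply/commG1P/trivgP; rewrite -tiH.
    apply: commg_subI; rewrite subsetI subxx.
      exact: subset_trans (normal_sub nsH1) (normal_norm nsH2).
    exact: subset_trans (normal_sub nsH2) (normal_norm nsH1).
  have defK : H1 \x H2 = (H1 <*> H2)%G by rewrite dprodEY.
  by exists (H1 <*> H2)%G; last exact: smU_dprod defK sm1 sm2.
split; first exact: satU.
split; last by split=> // rT K H sHK; apply: smU_sub.
split=> [rT sT K H isoKH | rT K N | rT K A B].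
- exact: smU_isog isoKH.
- exact: smU_quotient.
exact: smU_quotientI.
Qed.
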